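(* Let $J$ be one of the degree three Jordan algebras over $\mathbb{Q}$ listed in the context, let $V=V_J=\mathbb{Q}\oplus J\oplus J^\vee\oplus\mathbb{Q}$ with its quartic form $I_4$, and consider the canonical weight 3 Calabi–Yau variation of $\mathbb{Q}$-Hodge structure with underlying space $V$ over the Hermitian symmetric tube domain $\mathcal{M}$. Let $\gamma\in V$ be a charge vector such that $I_4(\gamma)>0$. Then any attractor point associated to $\gamma$ is a CM point.
   Context: **Jordan algebras.** $J$ is a $\mathbb{Q}$-vector space with a cubic norm structure: a unit $1_J$, a cubic form $N$, the symmetric trilinear form $(\cdot,\cdot,\cdot)$ with $(x,x,x)=6N(x)$, the trace form $(x,y)=\tfrac14(1_J,1_J,x)(1_J,1_J,y)-(1_J,x,y)$ (nondegenerate), and the quadratic map $\#:J\to J$ determined by $(x^\#,y)=\tfrac12(x,x,y)$. $J$ is one of: (i) $J=\mathbb{Q}$, $N(x)=x^3$; (ii) $J=\mathbb{Q}\oplus U$, $N(\alpha,u)=\alpha B(u)$, where $B$ is a nondegenerate quadratic form on $U$ which over $\mathbb{R}$ has Lorentzian signature (one positive and $n-1$ negative directions, $B(c_0)=1$ for a base point $c_0$, $1_J=(1,c_0)$); (iii) $J=\mathrm{Herm}_3(\mathbb{K})$, the $3\times 3$ Hermitian matrices over $\mathbb{K}$, where $\mathbb{K}$ is $\mathbb{Q}$, an imaginary quadratic field, a quaternion algebra over $\mathbb{Q}$ nonsplit at $\mathbb{R}$, or an octonion algebra over $\mathbb{Q}$ with $\mathbb{K}\otimes\mathbb{R}$ the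 division octonions, and $N$ is the determinant $N=abc+\mathrm{Tr}(xyz)-ax\bar x-by\bar y-cz\bar z$ for the matrix with diagonal entries $a,b,c$ and off-diagonal entries $z$ in position (1,2), $\bar y$ in (1,3), $x$ in (2,3). **The space $V$.** $V=V_J=\mathbb{Q}\oplus J\oplus J^\vee\oplus\mathbb{Q}$ with elements written $(p^0,p,q,q_0)$; $J^\vee$ is identified with $J$ by the trace form and so also carries $N$ and $\#$. Writing $V=(\mathbb{Q}\oplus J)\oplus(\mathbb{Q}\oplus J)^\vee$ gives a symplectic form $\omega=\langle\cdot,\cdot\rangle$. The quartic form is $$I_4(p^0,p,q,q_0)=4p^0N(q)-4q_0N(p)+4(q^\#,p^\#)-(p^0q_0+(p,q))^2 .$$ $G=G_J$ is the algebraic group of pairs $(\nu,g)\in\mathbb{G}_m\times GL(V)$ with $\langle gv,gw\rangle=\nu\langle v,w\rangle$ and $I_4(gv)=\nu^2I_4(v)$. **The domain and the variation of Hodge structure.** Let $\mathcal{O}\subset V_{\mathbb{C}}$ be the $G(\mathbb{C})$-orbit of $(1,0,0,0)$, a Lagrangian cone whose projectivization is a flag variety $G(\mathbb{C})/P$. To $[\Omega]\in\mathbb{P}(\mathcal{O})$ associate the filtration of $V_{\mathbb{C}}$: $F^3=\mathbb{C}\Omega$, $F^2=$ the (linear) tangent space to $\mathcal{O}$ at $\Omega$, $F^1=(F^3)^\perp$, $F^0=V_{\mathbb{C}}$. $\mathcal{M}\subset\mathbb{P}(\mathcal{O})$ is an open orbit of the identity component of $G(\mathbb{R})$, isomorphic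 to the Hermitian symmetric tube domain $D=G(\mathbb{R})/K$ ($K$ maximal compact modulo centre), at whose points this filtration is a weight 3 Hodge structure on $V$ polarized (up to sign) by $\omega$. This gives a $\mathbb{Q}$-variation of Hodge structure over $\mathcal{M}$ with Hodge numbers $(1,n,n,1)$, $n=\dim J=\dim_{\mathbb{C}}\mathcal{M}$ (Gross' canonical Calabi–Yau variation). **Attractor and CM points.** A point $x\in\mathcal{M}$ is an attractor point for $\gamma\in V$ if $\gamma\in H^{3,0}_x\oplus H^{0,3}_x$. A point $x$ is a CM point if the Mumford–Tate group of the rational Hodge structure on $V$ at $x$ is a torus. *)

(* Defs.v *)
(* R : realType is the field of real numbers, R[i] the field of complex numbers. *)
From HB Require Import structures.
From mathcomp Require Import all_boot all_order all_algebra.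
From mathcomp Require Import boolp classical_sets reals topology normedtype.
From mathcomp Require Import complex.
From mathcomp.multinomials Require mpoly.

Set Implicit Arguments.
Unset Strict Implicit.
Unset Printing Implicit Defensive.

Import Order.TTheory GRing.Theory Num.Theory.
Import numFieldNormedType.Exports.
Local Open Scope classical_set_scope.
Local Open Scope ring_scope.

(* A list [:: a_k; ...; a_1] of rationals encodes the algebra obtained from Q by
   k successive Cayley-Dickson doublings with parameters a_1, ..., a_k:
   Q (k = 0), Q(sqrt a_1) (k = 1), the quaternion algebra (a_1, a_2)_Q (k = 2),
   an octonion algebra (k = 3).  Its base change to a field F of characteristic
   0 is carried by 'rV[F]_(cd_dim s). *)
Fixpoint cd_dim (s : seq rat) : nat :=
  if s is _ :: s' then (cd_dim s' + cd_dim s')%N else 1%N.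

Fixpoint cd_conj (F : fieldType) (s : seq rat) :
    'rV[F]_(cd_dim s) -> 'rV[F]_(cd_dim s) :=
  match s with
  | [::] => fun x => x
  | _ :: s' => fun x => row_mx (cd_conj (lsubmx x)) (- rsubmx x)
  end.

(* (x, y)(u, v) = (xu + a v^* y, vx + y u^* ) *)
Fixpoint cd_mul (F : fieldType) (s : seq rat) :
    'rV[F]_(cd_dim s) -> 'rV[F]_(cd_dim s) -> 'rV[F]_(cd_dim s) :=
  match s with
  | [::] => fun x y => x *m y
  | a :: s' => fun p q =>
      let x := lsubmx p in let y := rsubmx p in
      let u := lsubmx q in let v := rsubmx q in
      row_mx (cd_mul x u + ratr a *: cd_mul (cd_conj v) y)
             (cd_mul v x + cd_mul y (cd_conj u))
  end.

(* The coordinate along the unit element. *)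
Fixpoint cd_re (F : fieldType) (s : seq rat) : 'rV[F]_(cd_dim s) -> F :=
  match s with
  | [::] => fun x => x 0 0
  | _ :: s' => fun x => cd_re (lsubmx x)
  end.

Definition cd_trace (F : fieldType) s (x : 'rV[F]_(cd_dim s)) : F :=
  cd_re (x + cd_conj x).

Definition cd_norm (F : fieldType) s (x : 'rV[F]_(cd_dim s)) : F :=
  cd_re (cd_mul x (cd_conj x)).

Definition cd_division (F : fieldType) (s : seq rat) : Prop :=
  forall x y : 'rV[F]_(cd_dim s), cd_mul x y = 0 -> x = 0 \/ y = 0.

(* [JSpin B c0] is Q (+) U with U = Q^m carrying the quadratic form of Gram
   matrix B; [JHerm s] is Herm_3 of the Cayley-Dickson algebra of s. *)
Inductive jordan : Type :=
| JLine
| JSpin (m : nat) (B : 'M[rat]_m) (c0 : 'rV[rat]_m)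
| JHerm (s : seq rat).

Definition qform (F : fieldType) m (B : 'M[F]_m) (u : 'rV[F]_m) : F :=
  (u *m B *m u^T) 0 0.

(* Signature (1, m - 1).  For m = 0 this is vacuous, but then no c0 satisfies
   B(c0) = 1 in [admissible]. *)
Definition lorentzian (R : realType) m (B : 'M[R]_m) : Prop :=
  exists2 P : 'M[R]_m, P \in unitmx &
    P *m B *m P^T = diag_mx (\row_i (if (i : nat) == 0%N then 1 else -1)).

(* For K the algebra of s, cd_division R s says that K (x) R is a division
   algebra: no condition for K = Q; K is an imaginary quadratic field; K is a
   quaternion algebra nonsplit at R; K (x) R is the division octonions. *)
Definition admissible (R : realType) (J : jordan) : Prop :=
  match J with
  | JLine => True
  | JSpin m B c0 =>
      [/\ B^T = B, B \in unitmx, lorentzian (map_mx (ratr : rat -> R) B)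
        & qform B c0 = 1]
  | JHerm s => [/\ (size s <= 3)%N, all (fun a => a != 0) s & cd_division R s]
  end.

Definition Jdim (J : jordan) : nat :=
  match J with
  | JLine => 1
  | JSpin m _ _ => (1 + m)%N
  | JHerm s => (3 + (cd_dim s + (cd_dim s + cd_dim s)))%N
  end.

(* The coordinates (a, b, c), x, y, z of the Hermitian matrix with diagonal
   a, b, c and entries z at (1,2), y^* at (1,3), x at (2,3). *)
Definition herm_norm (F : fieldType) s
    (v : 'rV[F]_(3 + (cd_dim s + (cd_dim s + cd_dim s)))) : F :=
  let a := lsubmx v 0 0 in let b := lsubmx v 0 1 in let c := lsubmx v 0 2 in
  let x := lsubmx (rsubmx v) in
  let y := lsubmx (rsubmx (rsubmx v)) in
  let z := rsubmx (rsubmx (rsubmx v)) in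
  a * b * c + cd_trace (cd_mul (cd_mul x y) z)
    - a * cd_norm x - b * cd_norm y - c * cd_norm z.

(* 'rV[F]_(Jdim J) is J (x)_Q F. *)
Definition Jnorm (F : fieldType) (J : jordan) : 'rV[F]_(Jdim J) -> F :=
  match J return 'rV[F]_(Jdim J) -> F with
  | JLine => fun x => x 0 0 ^+ 3
  | JSpin m B _ => fun x =>
      lsubmx x 0 0 * qform (map_mx ratr B) (rsubmx x)
  | JHerm s => @herm_norm F s
  end.

Definition Jone (F : fieldType) (J : jordan) : 'rV[F]_(Jdim J) :=
  match J return 'rV[F]_(Jdim J) with
  | JLine => const_mx 1
  | JSpin m _ c0 => row_mx (const_mx 1) (map_mx ratr c0)
  | JHerm s => row_mx (const_mx 1) 0
  end.

(* The symmetric trilinear form with (x, x, x) = 6 N(x). *)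
Definition Jtri (F : fieldType) J (x y z : 'rV[F]_(Jdim J)) : F :=
  Jnorm (x + y + z) - Jnorm (x + y) - Jnorm (y + z) - Jnorm (x + z)
    + Jnorm x + Jnorm y + Jnorm z.

Definition Jtr (F : fieldType) J (x y : 'rV[F]_(Jdim J)) : F :=
  let e := Jone F J in
  4^-1 * Jtri e e x * Jtri e e y - Jtri e x y.

(* The solution of Jtr (Jsharp x) y = 2^-1 * Jtri x x y for all y, by inversion
   of the Gram matrix of the (nondegenerate) trace form. *)
Definition Jsharp (F : fieldType) J (x : 'rV[F]_(Jdim J)) : 'rV[F]_(Jdim J) :=
  (\row_i (2^-1 * Jtri x x (delta_mx 0 i)))
    *m invmx (\matrix_(i, j) Jtr (delta_mx 0 i) (delta_mx 0 j)).

(* 'rV[F]_(Vdim J) is V_J (x)_Q F, with coordinates (p^0, p, q, q_0); the third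
   summand is J, identified with its dual by the trace form. *)
Definition Vdim (J : jordan) : nat := (1 + (Jdim J + (Jdim J + 1)))%N.

Definition Vp0 (F : fieldType) J (v : 'rV[F]_(Vdim J)) : F := lsubmx v 0 0.
Definition Vp (F : fieldType) J (v : 'rV[F]_(Vdim J)) : 'rV[F]_(Jdim J) :=
  lsubmx (rsubmx v).
Definition Vq (F : fieldType) J (v : 'rV[F]_(Vdim J)) : 'rV[F]_(Jdim J) :=
  lsubmx (rsubmx (rsubmx v)).
Definition Vq0 (F : fieldType) J (v : 'rV[F]_(Vdim J)) : F :=
  rsubmx (rsubmx (rsubmx v)) 0 0.

Definition symp (F : fieldType) J (v w : 'rV[F]_(Vdim J)) : F :=
  Vp0 v * Vq0 w + Jtr (Vp v) (Vq w) - Vq0 v * Vp0 w - Jtr (Vq v) (Vp w).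

Definition I4 (F : fieldType) J (v : 'rV[F]_(Vdim J)) : F :=
  4 * Vp0 v * Jnorm (Vq v) - 4 * Vq0 v * Jnorm (Vp v)
    + 4 * Jtr (Jsharp (Vq v)) (Jsharp (Vp v))
    - (Vp0 v * Vq0 v + Jtr (Vp v) (Vq v)) ^+ 2.

(* G(F).  Matrices act on row vectors from the right. *)
Definition GJ (F : fieldType) J : set 'M[F]_(Vdim J) :=
  [set g | g \in unitmx /\
    exists nu : F, [/\ nu != 0,
      forall v w, symp (v *m g) (w *m g) = nu * symp v w
    & forall v, I4 (v *m g) = nu ^+ 2 * I4 v]].

Definition Vbase (F : fieldType) J : 'rV[F]_(Vdim J) := row_mx (const_mx 1) 0.

(* The cone O, for F the field of complex numbers. *)
Definition Ocone (F : fieldType) J : set 'rV[F]_(Vdim J) :=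
  [set Vbase F J *m g | g in @GJ F J].

Definition subgroupGL (F : fieldType) N (H : set 'M[F]_N) : Prop :=
  [/\ H `<=` [set g | g \in unitmx], H 1%:M,
      forall g h, H g -> H h -> H (g *m h)
    & forall g, H g -> H (invmx g)].

(* The set of C-points of an algebraic subgroup, defined over Q, of GL_N. *)
Definition Qalg_subgroup (C : numClosedFieldType) N (H : set 'M[C]_N) : Prop :=
  subgroupGL H /\
  exists E : set (mpoly.mpoly (N * N) rat),
    H = [set g | g \in unitmx /\
      forall P, E P ->
        mpoly.meval (mxvec g 0) (mpoly.map_mpoly (ratr : rat -> C) P) = 0].

(* The coordinate ring of GL_m is generated by the entries g_ij and det(g)^-1. *)
Definition regular_on (C : fieldType) m n (H : set 'M[C]_m)
    (f : 'M[C]_m -> 'M[C]_n) : Prop :=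
  forall i j, exists P : mpoly.mpoly (m * m + 1) C, forall g, H g ->
    f g i j = mpoly.meval (row_mx (mxvec g) ((\det g)^-1)%:M 0) P.

Definition diag_torus (C : fieldType) r : set 'M[C]_r :=
  [set t | is_diag_mx t /\ t \in unitmx].

(* H is isomorphic, as an algebraic group over C, to a power of G_m. *)
Definition is_torus (C : fieldType) N (H : set 'M[C]_N) : Prop :=
  exists r (f : 'M[C]_r -> 'M[C]_N) (f' : 'M[C]_N -> 'M[C]_r),
    [/\ regular_on (@diag_torus C r) f /\ regular_on H f',
        forall t, diag_torus t -> H (f t) /\ f' (f t) = t,
        forall g, H g -> diag_torus (f' g) /\ f (f' g) = g
      & forall t u, diag_torus t -> diag_torus u -> f (t *m u) = f t *m f u].

Definition conjV (C : numClosedFieldType) N (v : 'rV[C]_N) : 'rV[C]_N :=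
  map_mx Num.conj v.

Definition subspace (C : fieldType) N (A : set 'rV[C]_N) : Prop :=
  A 0 /\ forall (a : C) u v, A u -> A v -> A (a *: u + v).

Definition direct_sum (C : fieldType) N (A B : set 'rV[C]_N) : Prop :=
  forall v, exists! ab : 'rV[C]_N * 'rV[C]_N,
    [/\ A ab.1, B ab.2 & v = ab.1 + ab.2].

Definition hodge_structure (C : numClosedFieldType) N (k : nat)
    (Fil : nat -> set 'rV[C]_N) : Prop :=
  [/\ forall p, subspace (Fil p),
      Fil 0%N = setT /\ Fil k.+1 = [set 0],
      forall p, Fil p.+1 `<=` Fil p
    & forall p, (p <= k.+1)%N ->
        direct_sum (Fil p) (@conjV C N @` Fil (k.+1 - p)%N)].

Definition hodge_comp (C : numClosedFieldType) N (Fil : nat -> set 'rV[C]_N)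
    (p q : nat) : set 'rV[C]_N := Fil p `&` (@conjV C N @` Fil q).

(* The Hodge-Riemann relations; i^(p - q) is written i^p (-i)^q. *)
Definition polarized (C : numClosedFieldType) N (k : nat)
    (Fil : nat -> set 'rV[C]_N) (S : 'rV[C]_N -> 'rV[C]_N -> C) : Prop :=
  (forall p r v w, (p <= k)%N -> (r <= k)%N -> (p + r)%N <> k ->
     hodge_comp Fil p (k - p) v -> hodge_comp Fil r (k - r) w -> S v w = 0) /\
  (forall p v, (p <= k)%N -> hodge_comp Fil p (k - p) v -> v != 0 ->
     0 < 'i ^+ p * (- 'i) ^+ (k - p) * S v (conjV v)).

(* h(z), acting on H^(p,q) as multiplication by z^p (z^* )^q. *)
Definition hodge_op (C : numClosedFieldType) N (k : nat)
    (Fil : nat -> set 'rV[C]_N) (z : C) : set 'M[C]_N :=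
  [set g | g \in unitmx /\
    forall p v, (p <= k)%N -> hodge_comp Fil p (k - p) v ->
      v *m g = (z ^+ p * z^* ^+ (k - p)) *: v].

(* C-points of the smallest algebraic subgroup of GL(V), defined over Q, that
   contains h(C^* ). *)
Definition mumford_tate (C : numClosedFieldType) N (k : nat)
    (Fil : nat -> set 'rV[C]_N) : set 'M[C]_N :=
  \bigcap_(H in [set H | Qalg_subgroup H /\
                  forall z : C, z != 0 -> hodge_op k Fil z `<=` H]) H.

(* The Zariski tangent space at x, as a linear subspace.  (An orbit of an
   algebraic group is smooth and open in its closure.) *)
Definition tangent_space (C : fieldType) N (S : set 'rV[C]_N) (x : 'rV[C]_N) :
    set 'rV[C]_N :=
  [set v | forall P : mpoly.mpoly N C,
     (forall y, S y -> mpoly.meval (y 0) P = 0) ->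
     \sum_i v 0 i * mpoly.meval (x 0) (mpoly.mderiv i P) = 0].

Definition CYfil (C : numClosedFieldType) J (Om : 'rV[C]_(Vdim J)) (p : nat) :
    set 'rV[C]_(Vdim J) :=
  match p with
  | 0 => setT
  | 1 => [set v | symp Om v = 0]
  | 2 => tangent_space (@Ocone C J) Om
  | 3 => [set c *: Om | c in setT]
  | _ => [set 0]
  end.

Definition centre (F : fieldType) N (Gam : set 'M[F]_N) : set 'M[F]_N :=
  [set z | Gam z /\ forall g, Gam g -> z *m g = g *m z].

Definition mulset (F : fieldType) N (A B : set 'M[F]_N) : set 'M[F]_N :=
  [set g | exists a b, [/\ A a, B b & g = a *m b]].

(* The image of K in Gam modulo its centre is compact. *)
Definition compact_mod_centre (R : realType) N (Gam K : set 'M[R]_N) : Prop :=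
  [/\ subgroupGL K, K `<=` Gam
    & exists A : set 'M[R]_N, [/\ compact A, A `<=` Gam
        & mulset K (centre Gam) = mulset A (centre Gam)]].

Definition maximal_compact_mod_centre (R : realType) N
    (Gam K : set 'M[R]_N) : Prop :=
  compact_mod_centre Gam K /\
  forall K', compact_mod_centre Gam K' -> K `<=` K' -> K' = K.

Definition GJR0 (R : realType) J : set 'M[R]_(Vdim J) :=
  connected_component (@GJ R J) 1%:M.

Definition cplx (R : realType) m n (g : 'M[R]_(m, n)) : 'M[R[i]]_(m, n) :=
  map_mx (real_complex R) g.

Definition stab_line (R : realType) J (Om : 'rV[R[i]]_(Vdim J)) :
    set 'M[R]_(Vdim J) :=
  [set g | @GJR0 R J g /\ exists2 c : R[i], c != 0 & Om *m cplx g = c *: Om].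

(* A subset of P(O) is represented by the cone over it (without 0).  M is an
   open orbit in P(O) of the identity component of G(R), of the form D = G/K
   with K maximal compact modulo centre, at whose points the filtration is a
   Hodge structure polarized, up to sign, by the symplectic form. *)
Definition CYdomain (R : realType) J (M : set 'rV[R[i]]_(Vdim J)) : Prop :=
  [/\ exists2 Om0, Ocone Om0 &
        M = [set v | exists c g, [/\ c != 0, @GJR0 R J g
                                   & v = c *: (Om0 *m cplx g)]] /\
        maximal_compact_mod_centre (@GJR0 R J) (stab_line Om0),
      exists2 U : set 'rV[R[i]^o]_(Vdim J), open U & M = @Ocone R[i] J `&` U
    & forall Om, M Om ->
        hodge_structure 3 (CYfil Om) /\
        exists2 e : R[i], e = 1 \/ e = -1 &
          polarized 3 (CYfil Om) (fun v w => e * symp v w)].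

Definition attractor_point (C : numClosedFieldType) J (gam : 'rV[rat]_(Vdim J))
    (Om : 'rV[C]_(Vdim J)) : Prop :=
  exists v w, [/\ hodge_comp (CYfil Om) 3 0 v, hodge_comp (CYfil Om) 0 3 w
                & map_mx ratr gam = v + w].

Definition CM_point (C : numClosedFieldType) J (Om : 'rV[C]_(Vdim J)) : Prop :=
  is_torus (mumford_tate 3 (CYfil Om)).

(* Main.v *)
Require Import Defs.
From mathcomp Require Import all_boot all_order all_algebra.
From mathcomp Require Import classical_sets reals topology normedtype complex.
From mathcomp Require Import boolp ring.
From mathcomp.multinomials Require Import(canonicals) mpoly.

(* Let gamma = W + conj W with W on the line H^{3,0} spanned by Om.  Write S4 for
   24 times the symmetric four-linear form of I4.  At the base point of the cone
   O one reads off S4(Om, Om, v, w) = -4 <Om, v> <Om, w>; both sides are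
   equivariant, so this holds on O, and differentiating it along the cone
   determines S4(Om, t, v, w) for t tangent to O, that is for t in F^2.  Hence the
   rational endomorphism A defined by <v A, w> = S4(gamma, gamma, v, w) acts on
   H^{2,1} and H^{1,2} as la and -la with la = -4 <W, conj W>, and sends gamma to
   3 la (W - conj W).  Moreover la^2 = -16 I4(gamma) is rational and nonzero and
   conj la = -la, so W and the four Hodge projectors are defined over the
   imaginary quadratic field Q(la).  The Mumford-Tate group is then the
   two-dimensional torus of the elements acting on H^{3-p,p} as u r^p. *)

(** The argument plays Q against C: A must be rational, while its eigenvalues come from complex
    Hodge theory. Hence [I4] is first given by one rational tensor [T], the same over every field,
    so that evaluation commutes with base change and with complex conjugation. The group G is known
    through values of [I4], and F^2 through polynomials vanishing on O; accordingly S4 at the base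
    point is recovered from values of [I4], and its tangent values from the polynomials y |-> S4(y,
    y, v, w) + 4 <y, v> <y, w>. Nondegeneracy of the symplectic form is drawn from the polarization.
    The vector W is not an eigenvector of A, so A serves to separate H^{2,1} from H^{1,2}, while the
    projector to H^{3,0} is built from W and the symplectic form. Since the Mumford-Tate group is an
    intersection over all algebraic groups over Q containing h, identifying it takes both rational
    equations for the torus, obtained by Galois descent, and the Zariski density of h in it. *)

Set Implicit Arguments.
Unset Strict Implicit.
Unset Printing Implicit Defensive.
Import Order.TTheory GRing.Theory Num.Theory.
Local Open Scope classical_set_scope.
Local Open Scope ring_scope.

(** * Polynomial functions with rational coefficients *)

(* Coefficients of a degree d form in n variables, over Q and not symmetrised; the
   same coefficients are evaluated over every field F of characteristic 0. *)
Fixpoint tens (n d : nat) : Type := if d is d'.+1 then 'I_n -> tens n d' else rat.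

(** A list that is too short is padded with zero vectors, so that identities such as [tev_map] carry
    no length condition. *)
Fixpoint tev (F : numFieldType) n d : tens n d -> seq 'rV[F]_n -> F :=
  match d with
  | 0 => fun T _ => ratr T
  | d'.+1 => fun T s => \sum_i head 0 s 0 i * tev (T i) (behead s)
  end.

Fixpoint tadd n d : tens n d -> tens n d -> tens n d :=
  match d with
  | 0 => fun T U => T + U
  | d'.+1 => fun T U i => tadd (T i) (U i)
  end.

Fixpoint tscale n d (c : rat) : tens n d -> tens n d :=
  match d with
  | 0 => fun T => c * T
  | d'.+1 => fun T i => tscale c (T i)
  end.

Fixpoint tmul n a b : tens n a -> tens n b -> tens n (a + b) :=
  match a with
  | 0 => fun T U => tscale T U
  | a'.+1 => fun T U i => tmul (T i) U
  end.

Lemma tev_tadd (F : numFieldType) n d (T U : tens n d) (s : seq 'rV[F]_n) :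
  tev (tadd T U) s = tev T s + tev U s.
Proof.
elim: d T U s => [|d IH] T U s /=; first by rewrite rmorphD.
by rewrite -big_split; apply: eq_bigr => i _; rewrite IH mulrDr.
Qed.

Lemma tev_tscale (F : numFieldType) n d c (T : tens n d) (s : seq 'rV[F]_n) :
  tev (tscale c T) s = ratr c * tev T s.
Proof.
elim: d T s => [|d IH] T s /=; first by rewrite rmorphM.
by rewrite big_distrr; apply: eq_bigr => i _; rewrite IH /= mulrCA.
Qed.

Lemma tev_tmul (F : numFieldType) n a b (T : tens n a) (U : tens n b)
    (s t : seq 'rV[F]_n) :
  size s = a -> tev (tmul T U) (s ++ t) = tev T s * tev U t.
Proof.
elim: a T s => [|a IH] T s; first by move/size0nil->; apply: tev_tscale.
case: s => [//|x s] [sz_s] /=.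
by rewrite big_distrl; apply: eq_bigr => i _; rewrite IH //= mulrA.
Qed.

Lemma tev_map (F F' : numFieldType) (phi : {rmorphism F -> F'}) n d
    (T : tens n d) (s : seq 'rV[F]_n) :
  tev T (map (map_mx phi) s) = phi (tev T s).
Proof.
elim: d T s => [|d IH] T s /=; first by rewrite fmorph_rat.
rewrite rmorph_sum; apply: eq_bigr => i _; rewrite rmorphM -IH.
by case: s => [|x s] /=; rewrite !mxE ?rmorph0.
Qed.

Lemma tev_linear (F : numFieldType) n d (T : tens n d) k (s t : seq 'rV[F]_n)
    (a : F) x y : size s = k -> (k < d)%N ->
  tev T (s ++ (a *: x + y) :: t) = a * tev T (s ++ x :: t) + tev T (s ++ y :: t).
Proof.
elim: d T k s => [//|d IH] T [|k] [|z s] //=; last first.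
  move=> [sz_s] ltkd; rewrite big_distrr -big_split; apply: eq_bigr => i _ /=.
  by rewrite (IH _ _ _ sz_s ltkd) mulrDr mulrCA.
move=> _ _.
rewrite big_distrr -big_split; apply: eq_bigr => i _ /=.
by rewrite !mxE mulrDl mulrA.
Qed.

(** The tensor is chosen before the field: a form over Q and its complexification are evaluations of
    the same coefficients. *)
Definition homog n d (f : forall F : numFieldType, 'rV[F]_n -> F) : Prop :=
  exists T : tens n d, forall (F : numFieldType) v, f F v = tev T (nseq d v).

Definition vhom n m d (f : forall F : numFieldType, 'rV[F]_n -> 'rV[F]_m) : Prop :=
  forall j, homog d (fun F v => f F v 0 j).

Section Hom.
Variable n : nat.
Implicit Types f g : forall F : numFieldType, 'rV[F]_n -> F.

Lemma hom_ext d f g : (forall F v, f F v = g F v) -> homog d g -> homog d f.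
Proof. by move=> fg [T gT]; exists T => F v; rewrite fg. Qed.

Lemma hom_const c : homog 0 (fun F (_ : 'rV[F]_n) => ratr c).
Proof. by exists c. Qed.

Lemma homD d f g : homog d f -> homog d g -> homog d (fun F v => f F v + g F v).
Proof.
by move=> [T fT] [U gU]; exists (tadd T U) => F v; rewrite tev_tadd fT gU.
Qed.

Lemma homZ d c f : homog d f -> homog d (fun F v => ratr c * f F v).
Proof. by move=> [T fT]; exists (tscale c T) => F v; rewrite tev_tscale fT. Qed.

Lemma homN d f : homog d f -> homog d (fun F v => - f F v).
Proof.
by move/(homZ (-1)); apply: hom_ext => F v; rewrite rmorphN1 mulN1r.
Qed.

Lemma homB d f g : homog d f -> homog d g -> homog d (fun F v => f F v - g F v).
Proof. by move=> hf /homN; apply: homD. Qed.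

Lemma homM a b f g : homog a f -> homog b g -> homog (a + b) (fun F v => f F v * g F v).
Proof.
move=> [T fT] [U gU]; exists (tmul T U) => F v.
by rewrite nseqD tev_tmul ?size_nseq // fT gU.
Qed.

Lemma hom_natM d k f : homog d f -> homog d (fun F v => k%:R * f F v).
Proof. by move/(homZ k%:R); apply: hom_ext => F v; rewrite ratr_nat. Qed.

Lemma hom0 d : homog d (fun F (_ : 'rV[F]_n) => 0).
Proof.
elim: d => [|d [T HT]].
  by apply: hom_ext (hom_const 0) => F v; rewrite rmorph0.
exists (fun _ => T) => F v /=; rewrite big1 // => i _.
by rewrite -HT mulr0.
Qed.

Lemma hom_sum d (I : finType) (f : I -> forall F : numFieldType, 'rV[F]_n -> F) :
  (forall i, homog d (f i)) -> homog d (fun F v => \sum_i f i F v).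
Proof.
move=> hf; pose s := index_enum I.
suff: homog d (fun F v => \sum_(i <- s) f i F v) by [].
elim: s => [|i s IH].
  by apply: hom_ext (hom0 d) => F v; rewrite big_nil.
by apply: hom_ext (homD (hf i) IH) => F v; rewrite big_cons.
Qed.

Lemma hom_coord i : homog 1 (fun F (v : 'rV[F]_n) => v 0 i).
Proof.
exists (fun j => (j == i)%:R) => F v /=.
rewrite (bigD1 i) //= eqxx rmorph1 mulr1 big1 ?addr0 // => j /negPf->.
by rewrite rmorph0 mulr0.
Qed.

Lemma vhom_id : vhom 1 (fun F (v : 'rV[F]_n) => v).
Proof. exact: hom_coord. Qed.

Lemma vhom_const m (c : 'rV[rat]_m) : vhom 0 (fun F (_ : 'rV[F]_n) => map_mx ratr c).
Proof. by move=> j; apply: hom_ext (hom_const (c 0 j)) => F v; rewrite mxE. Qed.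

Variables m p d : nat.
Implicit Types u w : forall F : numFieldType, 'rV[F]_n -> 'rV[F]_m.

Lemma vhomD u w : vhom d u -> vhom d w -> vhom d (fun F v => u F v + w F v).
Proof. by move=> hu hw j; apply: hom_ext (homD (hu j) (hw j)) => F v; rewrite mxE. Qed.

Lemma vhomN u : vhom d u -> vhom d (fun F v => - u F v).
Proof. by move=> hu j; apply: hom_ext (homN (hu j)) => F v; rewrite mxE. Qed.

Lemma vhomZ c u : vhom d u -> vhom d (fun F v => ratr c *: u F v).
Proof. by move=> hu j; apply: hom_ext (homZ c (hu j)) => F v; rewrite mxE. Qed.

Lemma vhom_row u (w : forall F : numFieldType, 'rV[F]_n -> 'rV[F]_p) :
  vhom d u -> vhom d w -> vhom d (fun F v => row_mx (u F v) (w F v)).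
Proof.
move=> hu hw j; case: (splitP j) => k jk.
  have {jk} ->: j = lshift p k by apply: val_inj.
  by apply: hom_ext (hu k) => F v; rewrite row_mxEl.
have {jk} ->: j = rshift m k by apply: val_inj.
by apply: hom_ext (hw k) => F v; rewrite row_mxEr.
Qed.

Lemma vhom_lsub (w : forall F : numFieldType, 'rV[F]_n -> 'rV[F]_(m + p)) :
  vhom d w -> vhom d (fun F v => lsubmx (w F v)).
Proof. by move=> hw j; apply: hom_ext (hw (lshift p j)) => F v; rewrite mxE. Qed.

Lemma vhom_rsub (w : forall F : numFieldType, 'rV[F]_n -> 'rV[F]_(m + p)) :
  vhom d w -> vhom d (fun F v => rsubmx (w F v)).
Proof. by move=> hw j; apply: hom_ext (hw (rshift m j)) => F v; rewrite mxE. Qed.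

Lemma hom_contract b u (h : 'I_m -> forall F : numFieldType, 'rV[F]_n -> F) :
  vhom d u -> (forall i, homog b (h i)) ->
  homog (d + b) (fun F v => \sum_i u F v 0 i * h i F v).
Proof. by move=> hu hh; apply: hom_sum => i; apply: homM. Qed.

End Hom.

(** * Homogeneity of the Cayley-Dickson operations and of the cubic norm *)

Section CayleyDickson.
Variable n : nat.

Lemma vhom_conj s d (u : forall F : numFieldType, 'rV[F]_n -> 'rV[F]_(cd_dim s)) :
  vhom d u -> vhom d (fun F v => cd_conj (u F v)).
Proof.
elim: s u => [//|a s IH] u hu /=.
apply: vhom_row; first by apply: (IH (fun F v => lsubmx (u F v))); apply: vhom_lsub.
by apply: vhomN; apply: vhom_rsub.
Qed.

Lemma vhom_mul s a b
    (u w : forall F : numFieldType, 'rV[F]_n -> 'rV[F]_(cd_dim s)) :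
  vhom a u -> vhom b w -> vhom (a + b) (fun F v => cd_mul (u F v) (w F v)).
Proof.
elim: s a b u w => [|c s IH] a b u w hu hw /=.
  move=> j; apply: hom_ext (homM (hu 0) (hw j)) => F v.
  by rewrite mxE big_ord1.
pose ul F v := lsubmx (u F v); pose ur F v := rsubmx (u F v).
pose wl F v := lsubmx (w F v); pose wr F v := rsubmx (w F v).
have hul : vhom a ul by apply: vhom_lsub.
have hur : vhom a ur by apply: vhom_rsub.
have hwl : vhom b wl by apply: vhom_lsub.
have hwr : vhom b wr by apply: vhom_rsub.
have ba : (b + a = a + b)%N := addnC b a.
apply: vhom_row; apply: vhomD.
- exact: (IH _ _ ul wl).
- apply: (@vhomZ _ _ _ c (fun F v => cd_mul (cd_conj (wr F v)) (ur F v))).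
  by rewrite -ba; apply: (IH _ _ (fun F v => cd_conj (wr F v)) ur) => //; apply: vhom_conj.
- by rewrite -ba; apply: (IH _ _ wr ul).
- by apply: (IH _ _ ur (fun F v => cd_conj (wl F v))) => //; apply: vhom_conj.
Qed.

Lemma hom_re s d (u : forall F : numFieldType, 'rV[F]_n -> 'rV[F]_(cd_dim s)) :
  vhom d u -> homog d (fun F v => cd_re (u F v)).
Proof.
elim: s u => [u hu|a s IH u hu] /=; first exact: hu.
by apply: (IH (fun F v => lsubmx (u F v))); apply: vhom_lsub.
Qed.

End CayleyDickson.

Lemma Jnorm_hom J : homog 3 (fun F : numFieldType => @Jnorm F J).
Proof.
case: J => [|m B c0|s] /=.
- have h := hom_coord (ord0 : 'I_1).
  apply: hom_ext (homM (homM h h) h) => F v.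
  by rewrite !exprS expr0 mulr1 mulrA.
- have hl : vhom 1 (fun F (x : 'rV[F]_(1 + m)) => lsubmx x).
    by apply: vhom_lsub; apply: vhom_id.
  have hr : vhom 1 (fun F (x : 'rV[F]_(1 + m)) => rsubmx x).
    by apply: vhom_rsub; apply: vhom_id.
  have h2 : homog 2 (fun F (x : 'rV[F]_(1 + m)) =>
      qform (map_mx ratr B) (rsubmx x)).
    have h i : homog 1 (fun F (x : 'rV[F]_(1 + m)) =>
        \sum_j rsubmx x 0 j * ratr (B j i)).
      by apply: (hom_contract hr) => j; apply: hom_const.
    apply: hom_ext (hom_contract hr h) => F x; rewrite /qform mxE.
    apply: eq_bigr => i _; rewrite !mxE mulrC; congr (_ * _).
    by apply: eq_bigr => j _; rewrite !mxE.
  exact: homM (hl 0) h2.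
set D := cd_dim s.
have h0 : vhom 1 (fun F (x : 'rV[F]_(3 + (D + (D + D)))) => rsubmx x).
  by apply: vhom_rsub; apply: vhom_id.
have h1 : vhom 1 (fun F (x : 'rV[F]_(3 + (D + (D + D)))) => lsubmx x).
  by apply: vhom_lsub; apply: vhom_id.
have hx : vhom 1 (fun F (x : 'rV[F]_(3 + (D + (D + D)))) => lsubmx (rsubmx x)).
  exact: vhom_lsub.
have h2 : vhom 1 (fun F (x : 'rV[F]_(3 + (D + (D + D)))) => rsubmx (rsubmx x)).
  exact: vhom_rsub.
have hy : vhom 1 (fun F (x : 'rV[F]_(3 + (D + (D + D)))) =>
    lsubmx (rsubmx (rsubmx x))).
  exact: vhom_lsub.
have hz : vhom 1 (fun F (x : 'rV[F]_(3 + (D + (D + D)))) =>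
    rsubmx (rsubmx (rsubmx x))).
  exact: vhom_rsub.
have hn u : vhom 1 u -> homog 2 (fun F (x : 'rV[F]_(3 + (D + (D + D)))) =>
    cd_norm (u F x : 'rV_(cd_dim s))).
  by move=> hu; apply: hom_re; apply: (vhom_mul hu); apply: vhom_conj.
rewrite /herm_norm; apply: homB; [apply: homB; [apply: homB; [apply: homD|]|]|].
- exact: homM (homM (h1 0) (h1 1)) (h1 2).
- apply: (@hom_re _ s 3 (fun F (v : 'rV[F]_(3 + (D + (D + D)))) => _ + _)).
  have h := vhom_mul (vhom_mul hx hy) hz.
  by apply: vhomD => //; apply: vhom_conj.
- exact: homM (h1 0) (hn _ hx).
- exact: homM (h1 1) (hn _ hy).
- exact: homM (h1 2) (hn _ hz).
Qed.

(** * The cubic, symplectic and quartic forms *)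

(** The sum over the six permutations is not divided by 6, in accordance with the normalisation (x,
    x, x) = 6 N(x). *)
Definition q3sym (F : ringType) (V : Type) (q : V -> V -> V -> F) x y z :=
  q x y z + q x z y + q y x z + q y z x + q z x y + q z y x.

Section Tev.
Variables (F : numFieldType) (n : nat).
Implicit Types (x y z : 'rV[F]_n) (a : F).

Lemma tev3_linear (T : tens n 3) a x y :
  [/\ forall z w, tev T [:: a *: x + y; z; w] = a * tev T [:: x; z; w] + tev T [:: y; z; w],
      forall z w, tev T [:: z; a *: x + y; w] = a * tev T [:: z; x; w] + tev T [:: z; y; w]
    & forall z w, tev T [:: z; w; a *: x + y] = a * tev T [:: z; w; x] + tev T [:: z; w; y]].
Proof.
split=> z w.
- exact: (@tev_linear _ _ _ _ 0 [::]).
- exact: (@tev_linear _ _ _ _ 1 [:: z]).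
- exact: (@tev_linear _ _ _ _ 2 [:: z; w]).
Qed.

Lemma tev3_add (T : tens n 3) x y :
  [/\ forall z w, tev T [:: x + y; z; w] = tev T [:: x; z; w] + tev T [:: y; z; w],
      forall z w, tev T [:: z; x + y; w] = tev T [:: z; x; w] + tev T [:: z; y; w]
    & forall z w, tev T [:: z; w; x + y] = tev T [:: z; w; x] + tev T [:: z; w; y]].
Proof.
have [h1 h2 h3] := tev3_linear T 1 x y.
by split=> z w; [move: (h1 z w)|move: (h2 z w)|move: (h3 z w)]; rewrite scale1r mul1r.
Qed.

End Tev.

Section Trilinear.
Variable J : jordan.

(** The alternating sum in [Jtri] cancels every term of the expanded cubic form that does not
    involve all three of x, y, z. Trilinearity, symmetry and compatibility with field morphisms are
    all read off from this form. *)
Lemma Jtri_tens : exists T : tens (Jdim J) 3, forall (F : numFieldType) (x y z : 'rV[F]_(Jdim J)),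
  Jtri x y z = q3sym (fun u v w => tev T [:: u; v; w]) x y z.
Proof.
have [T NT] := Jnorm_hom J; exists T => F x y z.
pose q u v w := tev T [:: u; v; w] : F.
have NE v : Jnorm v = q v v v by rewrite NT.
have A1 u v w t : q (u + v) w t = q u w t + q v w t by have [h _ _] := tev3_add T u v; apply: h.
have A2 u v w t : q w (u + v) t = q w u t + q w v t by have [_ h _] := tev3_add T u v; apply: h.
have A3 u v w t : q w t (u + v) = q w t u + q w t v by have [_ _ h] := tev3_add T u v; apply: h.
rewrite -[RHS]/(q3sym q x y z) /Jtri !NE !(A1, A2, A3) /q3sym.
ring.
Qed.

Variable F : numFieldType.
Implicit Types (x y z : 'rV[F]_(Jdim J)) (a : F).

Lemma Jtri_linear a x x' y z :
  Jtri (a *: x + x') y z = a * Jtri x y z + Jtri x' y z.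
Proof.
have [T TE] := Jtri_tens; rewrite !TE /q3sym.
have [h1 h2 h3] := tev3_linear T a x x'.
by rewrite !(h1, h2, h3); ring.
Qed.

Lemma Jtri_C12 x y z : Jtri x y z = Jtri y x z.
Proof. by have [T TE] := Jtri_tens; rewrite !TE /q3sym; ring. Qed.

Lemma Jtri_C23 x y z : Jtri x y z = Jtri x z y.
Proof. by have [T TE] := Jtri_tens; rewrite !TE /q3sym; ring. Qed.

Lemma Jtri_map (F' : numFieldType) (phi : {rmorphism F -> F'}) x y z :
  Jtri (map_mx phi x) (map_mx phi y) (map_mx phi z) = phi (Jtri x y z).
Proof.
have [T TE] := Jtri_tens; rewrite !TE /q3sym !rmorphD; cbv beta.
by rewrite -!(tev_map phi).
Qed.

Lemma Jone_map (F' : numFieldType) (phi : {rmorphism F -> F'}) :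
  map_mx phi (Jone F J) = Jone F' J.
Proof.
case: J => [|m B c0|s] /=; first by rewrite map_const_mx rmorph1.
  rewrite map_row_mx map_const_mx rmorph1 -map_mx_comp; congr row_mx.
  by apply: eq_map_mx => a /=; rewrite fmorph_rat.
by rewrite map_row_mx map_const_mx rmorph1 map_mx0.
Qed.

Lemma JtrC x y : Jtr x y = Jtr y x.
Proof. by rewrite /Jtr (Jtri_C23 _ x y); ring. Qed.

Lemma Jtr_linear x a y y' : Jtr x (a *: y + y') = a * Jtr x y + Jtr x y'.
Proof.
rewrite /Jtr !(Jtri_C23 _ _ (a *: y + y')) !(Jtri_C12 _ (a *: y + y')).
rewrite !Jtri_linear !(Jtri_C12 y) !(Jtri_C12 y') !(Jtri_C23 _ y) !(Jtri_C23 _ y').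
ring.
Qed.

Lemma Jtr_map (F' : numFieldType) (phi : {rmorphism F -> F'}) x y :
  Jtr (map_mx phi x) (map_mx phi y) = phi (Jtr x y).
Proof.
by rewrite /Jtr -(Jone_map phi) !Jtri_map !(rmorphM, rmorphB, fmorphV, rmorph_nat).
Qed.

End Trilinear.

Lemma bilinear_gram (F : fieldType) n (b : 'rV[F]_n -> 'rV[F]_n -> F) :
  (forall x a y y', b x (a *: y + y') = a * b x y + b x y') ->
  (forall y a x x', b (a *: x + x') y = a * b x y + b x' y) ->
  forall x y, b x y =
    (x *m (\matrix_(i, j) b (delta_mx 0 i) (delta_mx 0 j)) *m y^T) 0 0.
Proof.
move=> br bl x y.
have sumr z (I : finType) (f : I -> F) (g : I -> 'rV[F]_n) :
    b z (\sum_i f i *: g i) = \sum_i f i * b z (g i).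
  apply: (big_rec2 (fun u w => b z u = w)) => [|i u w _ <-].
    (* The case a = -1, y = y' = 0 of linearity gives b z 0 = 0. *)
    by have := br z (-1) 0 0; rewrite scaler0 addr0 mulN1r addNr.
  by rewrite br.
have suml z (I : finType) (f : I -> F) (g : I -> 'rV[F]_n) :
    b (\sum_i f i *: g i) z = \sum_i f i * b (g i) z.
  apply: (big_rec2 (fun u w => b u z = w)) => [|i u w _ <-].
    by have := bl z (-1) 0 0; rewrite scaler0 addr0 mulN1r addNr.
  by rewrite bl.
rewrite {1}(row_sum_delta x) {1}(row_sum_delta y) sumr mxE; apply: eq_bigr => j _.
rewrite suml !mxE mulrC; congr (_ * _); apply: eq_bigr => i _.
by rewrite !mxE.
Qed.

Section Symplectic.
Variables (J : jordan).

Definition Jgram (F : fieldType) : 'M[F]_(Jdim J) :=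
  \matrix_(i, j) Jtr (delta_mx 0 i) (delta_mx 0 j).

Lemma Jtr_gram (F : numFieldType) (x y : 'rV[F]_(Jdim J)) :
  Jtr x y = (x *m Jgram F *m y^T) 0 0.
Proof.
apply: (bilinear_gram (b := @Jtr F J)) => [u a v w|u a v w].
  exact: Jtr_linear.
by rewrite JtrC Jtr_linear !(JtrC u).
Qed.

Lemma Jgram_map (F F' : numFieldType) (phi : {rmorphism F -> F'}) :
  map_mx phi (Jgram F) = Jgram F'.
Proof. by apply/matrixP=> i j; rewrite !mxE -Jtr_map !map_delta_mx. Qed.

Variable F : numFieldType.
Implicit Types (v w : 'rV[F]_(Vdim J)) (a : F).

Lemma symp_anti v w : symp v w = - symp w v.
Proof. by rewrite /symp (JtrC (Vp v)) (JtrC (Vq v)); ring. Qed.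

Lemma symp_linear v a w w' : symp v (a *: w + w') = a * symp v w + symp v w'.
Proof.
rewrite /symp /Vp0 /Vp /Vq /Vq0 !linearP !Jtr_linear !mxE; ring.
Qed.

Lemma symp_map (F' : numFieldType) (phi : {rmorphism F -> F'}) v w :
  symp (map_mx phi v) (map_mx phi w) = phi (symp v w).
Proof.
rewrite /symp /Vp0 /Vp /Vq /Vq0 -!(map_lsubmx, map_rsubmx) !Jtr_map !mxE.
by rewrite !(rmorphD, rmorphN, rmorphM).
Qed.

Definition Vgram (K : fieldType) : 'M[K]_(Vdim J) :=
  \matrix_(i, j) symp (delta_mx 0 i) (delta_mx 0 j).

End Symplectic.

Section SymplecticGram.
Variables (J : jordan) (F : numFieldType).
Implicit Types (v w : 'rV[F]_(Vdim J)).

Lemma symp_gram v w : symp v w = (v *m Vgram J F *m w^T) 0 0.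
Proof.
apply: (bilinear_gram (b := @symp F J)) => [u a x y|u a x y].
  exact: symp_linear.
by rewrite symp_anti symp_linear !(symp_anti _ u); ring.
Qed.

Lemma Vgram_map (F' : numFieldType) (phi : {rmorphism F -> F'}) :
  map_mx phi (Vgram J F) = Vgram J F'.
Proof. by apply/matrixP=> i j; rewrite !mxE -symp_map !map_delta_mx. Qed.

End SymplecticGram.

(** * The quartic form as a rational tensor *)

Section Quartic.
Variable J : jordan.

Lemma Jtr_hom n a b (u w : forall F : numFieldType, 'rV[F]_n -> 'rV[F]_(Jdim J)) :
  vhom a u -> vhom b w -> homog (a + b) (fun F v => Jtr (u F v) (w F v)).
Proof.
move=> hu hw.
have h i : homog a (fun F v => \sum_j u F v 0 j * ratr (Jgram J rat j i)).
  by rewrite -[a]addn0; apply: (hom_contract hu) => j; apply: hom_const.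
rewrite addnC; apply: hom_ext (hom_contract hw h) => F v.
rewrite Jtr_gram mxE; apply: eq_bigr => i _; rewrite !mxE mulrC; congr (_ * _).
by apply: eq_bigr => j _; rewrite -(Jgram_map J (ratr : rat -> F)) mxE.
Qed.

Lemma tev_hom n m d b (T : tens m d)
    (u : forall F : numFieldType, 'rV[F]_n -> 'rV[F]_m) :
  vhom b u -> homog (d * b) (fun F v => tev T (nseq d (u F v))).
Proof.
move=> hu; elim: d T => [|d IH] T; first exact: hom_const.
exact: (hom_contract hu).
Qed.

Lemma Jnorm_vhom n b (u : forall F : numFieldType, 'rV[F]_n -> 'rV[F]_(Jdim J)) :
  vhom b u -> homog (3 * b) (fun F v => Jnorm (u F v)).
Proof.
move=> hu; have [T NT] := Jnorm_hom J.
by apply: hom_ext (tev_hom T hu) => F v; rewrite NT.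
Qed.

(** The matrix inverted in [Jsharp] is the image of a rational Gram matrix, and matrix inversion
    commutes with field morphisms; so the inverse contributes rational constants and only [Jtri x x]
    depends on x. *)
Lemma Jsharp_vhom : vhom 2 (fun F (x : 'rV[F]_(Jdim J)) => Jsharp x).
Proof.
have [T TE] := Jtri_tens J.
have hx := @vhom_id (Jdim J).
have he i : vhom 0 (fun F (_ : 'rV[F]_(Jdim J)) => delta_mx 0 i : 'rV[F]_(Jdim J)).
  move=> j; have h := @vhom_const (Jdim J) _ (delta_mx 0 i) j.
  apply: hom_ext h => F v; by rewrite map_delta_mx.
have h3 i : homog 2 (fun F (x : 'rV[F]_(Jdim J)) => Jtri x x (delta_mx 0 i)).
  have h1 : homog 2 (fun F (x : 'rV[F]_(Jdim J)) => tev T [:: x; x; delta_mx 0 i]).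
    by do 2! (apply: (hom_contract hx) => ?); apply: (hom_contract (he i)) => ?; apply: hom_const.
  have h2 : homog 2 (fun F (x : 'rV[F]_(Jdim J)) => tev T [:: x; delta_mx 0 i; x]).
    by apply: (hom_contract hx) => ?; apply: (hom_contract (he i)) => ?;
      apply: (hom_contract hx) => ?; apply: hom_const.
  have h4 : homog 2 (fun F (x : 'rV[F]_(Jdim J)) => tev T [:: delta_mx 0 i; x; x]).
    by apply: (hom_contract (he i)) => ?;
      do 2! (apply: (hom_contract hx) => ?); apply: hom_const.
  (* With two equal arguments the six terms of [q3sym] coincide in pairs. *)
  have h := homD (homD (homD (homD (homD h1 h2) h1) h2) h4) h4.
  apply: hom_ext h => F x.
  by rewrite TE /q3sym; ring.
move=> j.
have h5 : homog 2 (fun F (x : 'rV[F]_(Jdim J)) => \sum_i Jtri x x (delta_mx 0 i) *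
     (ratr (2^-1 * invmx (Jgram J rat) i j))).
  by apply: hom_sum => i; apply: (homM (h3 i)); apply: hom_const.
apply: hom_ext h5 => F x; rewrite /Jsharp mxE; apply: eq_bigr => i _.
rewrite rmorphM fmorphV rmorph_nat !mxE mulrA -/(Jgram J F).
by rewrite -(Jgram_map J (ratr : rat -> F)) -map_invmx [in RHS]mulrC !mxE; ring.
Qed.

Lemma I4_hom : homog 4 (fun F : numFieldType => @I4 F J).
Proof.
have hr : vhom 1 (fun F (v : 'rV[F]_(Vdim J)) => rsubmx v).
  by apply: vhom_rsub; apply: vhom_id.
have hrr : vhom 1 (fun F (v : 'rV[F]_(Vdim J)) => rsubmx (rsubmx v)).
  exact: vhom_rsub.
have hp0 : homog 1 (fun F (v : 'rV[F]_(Vdim J)) => Vp0 v).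
  by apply: (@vhom_lsub _ 1 _ 1 (fun F (v : 'rV[F]_(Vdim J)) => v)); apply: vhom_id.
have hp : vhom 1 (fun F (v : 'rV[F]_(Vdim J)) => Vp v) by apply: vhom_lsub.
have hq : vhom 1 (fun F (v : 'rV[F]_(Vdim J)) => Vq v) by apply: vhom_lsub.
have hq0 : homog 1 (fun F (v : 'rV[F]_(Vdim J)) => Vq0 v).
  exact: (@vhom_rsub _ _ 1 1 (fun F (v : 'rV[F]_(Vdim J)) => rsubmx (rsubmx v))).
have hs u : vhom 1 u -> vhom 2 (fun F (v : 'rV[F]_(Vdim J)) => Jsharp (u F v : 'rV_(Jdim J))).
  move=> hu j; have [T TE] := Jsharp_vhom j.
  by apply: hom_ext (tev_hom T hu) => F v; rewrite TE.
have hd : homog 2 (fun F (v : 'rV[F]_(Vdim J)) => Vp0 v * Vq0 v + Jtr (Vp v) (Vq v)).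
  by apply: homD; [apply: (homM hp0 hq0) | apply: (Jtr_hom hp hq)].
apply: homB; [apply: homD; [apply: homB|]|].
- exact: homM (hom_natM 4 hp0) (Jnorm_vhom hq).
- exact: homM (hom_natM 4 hq0) (Jnorm_vhom hp).
- exact: hom_natM (Jtr_hom (hs _ hq) (hs _ hp)).
- exact: (homM hd hd).
Qed.

End Quartic.

(** * Full polarisation of the quartic form *)

Definition q4sym (F : ringType) (V : Type) (q : V -> V -> V -> V -> F) x y z w :=
  q3sym (q x) y z w + q3sym (q y) x z w + q3sym (q z) x y w + q3sym (q w) x y z.

Section SymmetricFourLinear.
Variables (F : numFieldType) (V : lmodType F) (q : V -> V -> V -> V -> F).
Hypothesis L1 : forall a u v w s t, q (a *: u + v) w s t = a * q u w s t + q v w s t.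
Hypothesis L2 : forall a u v w s t, q w (a *: u + v) s t = a * q w u s t + q w v s t.
Hypothesis L3 : forall a u v w s t, q w s (a *: u + v) t = a * q w s u t + q w s v t.
Hypothesis L4 : forall a u v w s t, q w s t (a *: u + v) = a * q w s t u + q w s t v.

Lemma q4sym_linear a x x' y z w :
  q4sym q (a *: x + x') y z w = a * q4sym q x y z w + q4sym q x' y z w.
Proof. rewrite /q4sym /q3sym !(L1, L2, L3, L4); ring. Qed.

Lemma q4sym_C12 x y z w : q4sym q x y z w = q4sym q y x z w.
Proof. rewrite /q4sym /q3sym; ring. Qed.

Lemma q4sym_C23 x y z w : q4sym q x y z w = q4sym q x z y w.
Proof. rewrite /q4sym /q3sym; ring. Qed.

Lemma q4sym_C34 x y z w : q4sym q x y z w = q4sym q x y w z.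
Proof. rewrite /q4sym /q3sym; ring. Qed.

Lemma q4sym_diag x : q4sym q x x x x = 24 * q x x x x.
Proof. rewrite /q4sym /q3sym; ring. Qed.

End SymmetricFourLinear.

Section SecondDifference.
Variables (F : numFieldType) (V : lmodType F) (S : V -> V -> V -> V -> F) (f : V -> F).
Hypothesis S_linear : forall a x x' y z w,
  S (a *: x + x') y z w = a * S x y z w + S x' y z w.
Hypothesis S_C12 : forall x y z w, S x y z w = S y x z w.
Hypothesis S_C23 : forall x y z w, S x y z w = S x z y w.
Hypothesis S_C34 : forall x y z w, S x y z w = S x y w z.
Hypothesis S_diag : forall x, S x x x x = 24 * f x.

Let S_linear2 a x x' y z w : S y (a *: x + x') z w = a * S y x z w + S y x' z w.
Proof. by rewrite S_C12 S_linear (S_C12 x) (S_C12 x'). Qed.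

Let S_linear3 a x x' y z w : S y z (a *: x + x') w = a * S y z x w + S y z x' w.
Proof. by rewrite S_C23 S_linear2 (S_C23 _ x) (S_C23 _ x'). Qed.

Let S_linear4 a x x' y z w : S y z w (a *: x + x') = a * S y z w x + S y z w x'.
Proof. by rewrite S_C34 S_linear3 (S_C34 _ _ x) (S_C34 _ _ x'). Qed.

(* The s^2-coefficient of f (x + s v) is read off its values at s = 0, 1, -1, 2, -2. *)
Lemma second_difference x v :
  6 * S x x v v = 16 * (f (x + v) + f (x - v)) - f (x + 2 *: v)
    - f (x - 2 *: v) - 30 * f x.
Proof.
have E s : 24 * f (s *: v + x) = f x * 24 + 4 * s * S x x x v
    + 6 * s ^+ 2 * S x x v v + 4 * s ^+ 3 * S x v v v + s ^+ 4 * S v v v v.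
  rewrite -S_diag !(S_linear, S_linear2, S_linear3, S_linear4) (S_diag x).
  have e1 : S v x x x = S x x x v by rewrite S_C12 S_C23 S_C34.
  have e2 : S x v x x = S x x x v by rewrite S_C23 S_C34.
  have e3 : S x x v x = S x x x v by rewrite S_C34.
  have e4 : S v v x x = S x x v v by rewrite S_C23 S_C12 S_C34 S_C23.
  have e5 : S v x v x = S x x v v by rewrite S_C12 S_C34 S_C23.
  have e6 : S v x x v = S x x v v by rewrite S_C12 S_C23.
  have e7 : S x v v x = S x x v v by rewrite S_C34 S_C23.
  have e8 : S x v x v = S x x v v by rewrite S_C23.
  have e9 : S v v v x = S x v v v by rewrite S_C34 S_C23 S_C12.
  have e10 : S v v x v = S x v v v by rewrite S_C23 S_C12.
  have e11 : S v x v v = S x v v v by rewrite S_C12.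
  rewrite e1 e2 e3 e4 e5 e6 e7 e8 e9 e10 e11; ring.
(* The weights 16, 16, -1, -1 cancel the odd powers of s by parity and s^4 because 16 + 16 = 2 *
   2^4; the weight left on s^2 is 32 - 8 = 24, and 32 - 2 = 30 on the constant term. *)
have := (E 1, E (-1), E 2, E (-2)).
rewrite !scaleNr scale1r !(addrC _ x) => -[[[E1 E2] E3] E4].
apply: (@mulfI _ 24); first by rewrite pnatr_eq0.
transitivity (16 * (24 * f (x + v) + 24 * f (x - v)) - 24 * f (x + 2 *: v)
    - 24 * f (x - 2 *: v) - 30 * (24 * f x)); last by ring.
rewrite E1 E2 E3 E4; ring.
Qed.

End SecondDifference.

Section Polarization.
Variables (J : jordan) (T : tens (Vdim J) 4).
Hypothesis I4T : forall (F : numFieldType) (v : 'rV[F]_(Vdim J)),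
  I4 v = tev T (nseq 4 v).

Definition S4 (F : numFieldType) : 'rV[F]_(Vdim J) -> 'rV[F]_(Vdim J) ->
    'rV[F]_(Vdim J) -> 'rV[F]_(Vdim J) -> F :=
  q4sym (fun x y z w => tev T [:: x; y; z; w]).

Lemma S4_map (F F' : numFieldType) (phi : {rmorphism F -> F'}) x y z w :
  S4 (map_mx phi x) (map_mx phi y) (map_mx phi z) (map_mx phi w) = phi (S4 x y z w).
Proof.
by rewrite /S4 /q4sym /q3sym !rmorphD; cbv beta; rewrite -!(tev_map phi).
Qed.

Variable F : numFieldType.
Implicit Types (x y z v w : 'rV[F]_(Vdim J)) (a : F).

Lemma S4_diag v : S4 v v v v = 24 * I4 v.
Proof. by rewrite I4T; apply: q4sym_diag. Qed.

Lemma S4_linear a x x' y z w : S4 (a *: x + x') y z w = a * S4 x y z w + S4 x' y z w.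
Proof.
apply: q4sym_linear => b u v u1 u2 u3.
- exact: (@tev_linear _ _ _ _ 0 [::]).
- exact: (@tev_linear _ _ _ _ 1 [:: _]).
- exact: (@tev_linear _ _ _ _ 2 [:: _; _]).
- exact: (@tev_linear _ _ _ _ 3 [:: _; _; _]).
Qed.

Lemma S4_C12 x y z w : S4 x y z w = S4 y x z w.
Proof. exact: q4sym_C12. Qed.

Lemma S4_C23 x y z w : S4 x y z w = S4 x z y w.
Proof. exact: q4sym_C23. Qed.

Lemma S4_C34 x y z w : S4 x y z w = S4 x y w z.
Proof. exact: q4sym_C34. Qed.

Lemma S4_linear2 a x x' y z w : S4 y (a *: x + x') z w = a * S4 y x z w + S4 y x' z w.
Proof. by rewrite S4_C12 S4_linear (S4_C12 x) (S4_C12 x'). Qed.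

Lemma S4_linear3 a x x' y z w : S4 y z (a *: x + x') w = a * S4 y z x w + S4 y z x' w.
Proof. by rewrite S4_C23 S4_linear2 (S4_C23 _ x) (S4_C23 _ x'). Qed.

Lemma S4_linear4 a x x' y z w : S4 y z w (a *: x + x') = a * S4 y z w x + S4 y z w x'.
Proof. by rewrite S4_C34 S4_linear3 (S4_C34 _ _ x) (S4_C34 _ _ x'). Qed.

Lemma S4_second_difference x v :
  6 * S4 x x v v = 16 * (I4 (x + v) + I4 (x - v)) - I4 (x + 2 *: v)
    - I4 (x - 2 *: v) - 30 * I4 x.
Proof.
exact: (second_difference S4_linear S4_C12 S4_C23 S4_C34 S4_diag).
Qed.

End Polarization.

Arguments S4 {J} T {F}.

(** * The cone O and its tangent spaces *)

Lemma homog_scale n d (f : forall F : numFieldType, 'rV[F]_n -> F)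
    (F : numFieldType) (a : F) v :
  homog d f -> f F (a *: v) = a ^+ d * f F v.
Proof.
move=> [T fT]; rewrite !fT; elim: d T {fT} => [|d IH] T /=; first by rewrite expr0 mul1r.
by rewrite big_distrr; apply: eq_bigr => i _ /=; rewrite IH mxE exprS; ring.
Qed.

Section Base.
Variables (J : jordan) (F : numFieldType).
Implicit Types (v w : 'rV[F]_(Vdim J)).

Lemma Jtr0l (x : 'rV[F]_(Jdim J)) : Jtr 0 x = 0.
Proof. by have := Jtr_linear x (-1) 0 0; rewrite scaler0 addr0 mulN1r addNr JtrC. Qed.

Lemma JtrZl a (x y : 'rV[F]_(Jdim J)) : Jtr (a *: x) y = a * Jtr x y.
Proof. by rewrite JtrC -[a *: x]addr0 Jtr_linear (JtrC y 0) Jtr0l addr0 JtrC. Qed.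

Lemma JtrZr a (x y : 'rV[F]_(Jdim J)) : Jtr x (a *: y) = a * Jtr x y.
Proof. by rewrite JtrC JtrZl JtrC. Qed.

Lemma Vp0_base v : Vp0 (Vbase F J + v) = 1 + Vp0 v.
Proof. by rewrite /Vp0 /Vbase raddfD /= row_mxKl !mxE. Qed.

Lemma Vp_base v : Vp (Vbase F J + v) = Vp v.
Proof. by rewrite /Vp /Vbase !raddfD /= row_mxKr [lsubmx 0]raddf0 add0r. Qed.

Lemma Vq_base v : Vq (Vbase F J + v) = Vq v.
Proof.
by rewrite /Vq /Vbase !raddfD /= row_mxKr [rsubmx 0]raddf0 [lsubmx 0]raddf0 add0r.
Qed.

Lemma Vq0_base v : Vq0 (Vbase F J + v) = Vq0 v.
Proof.
by rewrite /Vq0 /Vbase !raddfD /= row_mxKr !raddf0 add0r.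
Qed.

Lemma symp_base v : symp (Vbase F J) v = Vq0 v.
Proof.
rewrite -[Vbase F J]addr0 /symp Vp0_base Vp_base Vq_base Vq0_base.
by rewrite /Vp0 /Vp /Vq /Vq0 !raddf0 !Jtr0l !mxE; ring.
Qed.

Lemma I4_base v : I4 (Vbase F J + v) =
  I4 v + 4 * Jnorm (Vq v) - 2 * Vq0 v * (Vp0 v * Vq0 v + Jtr (Vp v) (Vq v))
    - Vq0 v ^+ 2.
Proof. rewrite /I4 Vp0_base Vp_base Vq_base Vq0_base; ring. Qed.

(** What matters is the coefficient of a^2: it is - <1, v>^2, with 1 the base point, and equals a
    quarter of S4(1, 1, v, v). This is the origin of the factor -4 in [S4_cone]. *)
Lemma I4_base_scale a v : I4 (Vbase F J + a *: v) =
  a ^+ 4 * I4 v + 4 * a ^+ 3 * Jnorm (Vq v)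
   - 2 * a ^+ 3 * Vq0 v * (Vp0 v * Vq0 v + Jtr (Vp v) (Vq v))
    - a ^+ 2 * Vq0 v ^+ 2.
Proof.
rewrite I4_base (homog_scale _ _ (I4_hom J)).
have -> : Vp0 (a *: v) = a * Vp0 v by rewrite /Vp0 linearZ mxE.
have -> : Vp (a *: v) = a *: Vp v by rewrite /Vp !linearZ.
have -> : Vq (a *: v) = a *: Vq v by rewrite /Vq !linearZ.
have -> : Vq0 (a *: v) = a * Vq0 v by rewrite /Vq0 !linearZ mxE.
rewrite (homog_scale _ _ (Jnorm_hom J)) JtrZl JtrZr; ring.
Qed.

End Base.

Section Cone.
Variables (J : jordan) (T : tens (Vdim J) 4).
Hypothesis I4T : forall (F : numFieldType) (v : 'rV[F]_(Vdim J)),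
  I4 v = tev T (nseq 4 v).
Variable F : numFieldType.
Implicit Types (x v w om : 'rV[F]_(Vdim J)).

Lemma I4_0 : I4 (0 : 'rV[F]_(Vdim J)) = 0.
Proof. by have := homog_scale (0 : F) 0 (I4_hom J); rewrite scaler0 expr0n mul0r => ->. Qed.

(** An element of G is known to scale values of [I4]. Second differences express S4(om, om, v, v) by
    such values, so the multiplier nu^2 comes out on both sides and the identity moves to the base
    point. *)
Lemma S4_cone_diag om v : Ocone om -> S4 T om om v v = - 4 * symp om v ^+ 2.
Proof.
case=> g [gu [nu [nu0 gsymp gI4]]] <-.
have [u ->] : exists u, v = u *m g by exists (v *m invmx g); rewrite mulmxKV.
rewrite gsymp symp_base; apply: (@mulfI _ 6); first by rewrite pnatr_eq0.
rewrite (S4_second_difference I4T) !scalemxAl -!(mulmxDl, mulmxBl) !gI4.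
have e1 : u = 1 *: u by rewrite scale1r.
rewrite {1 2}e1 -!scaleNr !I4_base_scale -[Vbase F J]addr0 I4_base I4_0.
rewrite /Vq0 /Vq /Vp /Vp0 !raddf0 Jtr0l.
have -> : Jnorm (0 : 'rV[F]_(Jdim J)) = 0.
  by have := homog_scale (0 : F) 0 (Jnorm_hom J); rewrite scaler0 expr0n mul0r => ->.
rewrite !mxE; ring.
Qed.

Lemma sympDr x v w : symp x (v + w) = symp x v + symp x w.
Proof. by rewrite -{1}[v]scale1r symp_linear mul1r. Qed.

Lemma S4_cone om v w : Ocone om -> S4 T om om v w = - 4 * (symp om v * symp om w).
Proof.
move=> Oom; have := S4_cone_diag (1 *: v + w) Oom.
rewrite S4_linear3 !S4_linear4 !S4_cone_diag // scale1r sympDr.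
rewrite (S4_C34 _ _ _ w v) !mul1r => E.
apply: (@mulfI _ 2); first by rewrite pnatr_eq0.
transitivity (- 4 * (symp om v + symp om w) ^+ 2 - (- 4 * symp om v ^+ 2)
    - (- 4 * symp om w ^+ 2)); last by ring.
by rewrite -E; ring.
Qed.
End Cone.

(** * Differentials of quadratic forms along a tangent space *)

Section QuadraticTangent.
Variables (F : fieldType) (n : nat).

Lemma mderivXU (i k : 'I_n) :
  mpoly.mderiv k (mpoly.mpolyX F (mpoly.mnm1 i)) = mpoly.mpolyC n (k == i)%:R.
Proof.
rewrite mpoly.mderivX mpoly.mnm1E eq_sym; case: eqVneq => [->|_].
  rewrite scale1r; suff -> : mpoly.mnm_sub (mpoly.mnm1 i) (mpoly.mnm1 i) = mpoly.mnm0
    by rewrite mpoly.mpolyX0 mpoly.mpolyC1.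
  by apply/mpoly.mnmP => j; rewrite mpoly.mnmBE subnn mpoly.mnm0E.
by rewrite scale0r mpoly.mpolyC0.
Qed.

(** The function y |-> b y y is a polynomial [P] vanishing on S, and the left-hand side of the
    conclusion is its differential at x in the direction t. The form b need not be symmetric. *)
Lemma tangent_quadratic (S : set 'rV[F]_n) (b : 'rV[F]_n -> 'rV[F]_n -> F) x t :
  (forall x a y y', b x (a *: y + y') = a * b x y + b x y') ->
  (forall y a x x', b (a *: x + x') y = a * b x y + b x' y) ->
  (forall y, S y -> b y y = 0) ->
  tangent_space S x t -> b t x + b x t = 0.
Proof.
move=> br bl b0 tt; have bE := bilinear_gram br bl.
set M := (\matrix_(i, j) _) in bE.
have bE2 y z : b y z = \sum_i \sum_j M i j * (y 0 i * z 0 j).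
  rewrite bE mxE exchange_big; apply: eq_bigr => j _; rewrite mxE mulr_suml.
  by apply: eq_bigr => i _; rewrite [z^T _ _]mxE; ring.
pose X i : mpoly.mpoly n F := mpoly.mpolyX F (mpoly.mnm1 i).
pose P : mpoly.mpoly n F := \sum_i \sum_j (mpoly.mpolyC n (M i j) * (X i * X j)).
have Pev (y : 'rV[F]_n) : mpoly.meval (y 0) P = b y y.
  rewrite bE2 rmorph_sum; apply: eq_bigr => i _; rewrite rmorph_sum.
  apply: eq_bigr => j _.
  by rewrite /= !mpoly.mevalM mpoly.mevalC !mpoly.mevalXU.
have /tt <- : forall y, S y -> mpoly.meval (y 0) P = 0.
  by move=> y Sy; rewrite Pev b0.
 rewrite !bE2 -big_split.
have dP k : mpoly.meval (x 0) (mpoly.mderiv k P) =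
    \sum_i \sum_j M i j * ((k == i)%:R * x 0 j + x 0 i * (k == j)%:R).
  rewrite /P [mpoly.mderiv k _]raddf_sum [mpoly.meval _ _]raddf_sum.
  apply: eq_bigr => i _.
  rewrite -[LHS]/(mpoly.meval (x 0) (mpoly.mderiv k
    (\sum_j (mpoly.mpolyC n (M i j) * (X i * X j))))).
  rewrite [mpoly.mderiv k _]raddf_sum [mpoly.meval _ _]raddf_sum.
  apply: eq_bigr => j _.
  rewrite -[LHS]/(mpoly.meval (x 0) (mpoly.mderiv k (mpoly.mpolyC n (M i j) * (X i * X j)))).
  rewrite mpoly.mderiv_mulC mpoly.mderivM !mderivXU.
  by rewrite !(mpoly.mevalD, mpoly.mevalM, mpoly.mevalC, mpoly.mevalXU).
under [RHS]eq_bigr => k _ do rewrite dP big_distrr.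
rewrite [RHS]exchange_big; apply: eq_bigr => i _.
under [RHS]eq_bigr => k _ do rewrite /= big_distrr.
rewrite [RHS]exchange_big -big_split; apply: eq_bigr => j _ /=.
have sd (l : 'I_n) : \sum_k t 0 k * (k == l)%:R = t 0 l.
  rewrite (bigD1 l) //= eqxx mulr1 big1 ?addr0 // => k /negPf->.
  by rewrite mulr0.
rewrite -(sd i) -(sd j) mulr_suml !mulr_sumr -big_split.
by apply: eq_bigr => k _ /=; ring.
Qed.

End QuadraticTangent.

Section ConeTangent.
Variables (J : jordan) (T : tens (Vdim J) 4).
Hypothesis I4T : forall (F : numFieldType) (v : 'rV[F]_(Vdim J)),
  I4 v = tev T (nseq 4 v).
Variable F : numFieldType.
Implicit Types (t v w om : 'rV[F]_(Vdim J)).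

Lemma symp_linear_l v a w w' :
  symp (a *: w + w' : 'rV[F]_(Vdim J)) v = a * symp w v + symp w' v.
Proof. by rewrite symp_anti symp_linear !(symp_anti v); ring. Qed.

(** The constant is half of that in [S4_cone]: om occurs twice in S4(om, om, v, w), so its
    derivative is 2 S4(om, t, v, w), while the product of pairings yields two distinct terms. *)
Lemma S4_tangent om t v w : Ocone om -> tangent_space (@Ocone F J) om t ->
  S4 T om t v w = - 2 * (symp t v * symp om w + symp om v * symp t w).
Proof.
move=> Oom tt.
(* By S4_cone the quadratic form y |-> b y y vanishes on the cone. *)
pose b x y := S4 T x y v w + 4 * (symp x v * symp y w).
have br x a y y' : b x (a *: y + y') = a * b x y + b x y'.
  by rewrite /b S4_linear2 symp_linear_l; ring.
have bl y a x x' : b (a *: x + x') y = a * b x y + b x' y.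
  by rewrite /b S4_linear symp_linear_l; ring.
have b0 y : Ocone y -> b y y = 0.
  by move=> Oy; rewrite /b (S4_cone I4T) //; ring.
have := tangent_quadratic br bl b0 tt; rewrite /b (S4_C12 _ t) => E.
apply: (@mulfI _ 2); first by rewrite pnatr_eq0.
apply: subr0_eq; rewrite -E; ring.
Qed.

End ConeTangent.

(** * Galois descent and regular functions *)

Section RationalFunctions.
Variables (C : numClosedFieldType) (N : nat) (dl : C).
Implicit Types (f h : 'M[C]_N -> C) (g : 'M[C]_N).

Definition ratpoly f := exists P : mpoly.mpoly (N * N) rat,
  forall g, f g = mpoly.meval (mxvec g 0) (mpoly.map_mpoly (ratr : rat -> C) P).

Lemma ratpolyC a : ratpoly (fun _ => ratr a).
Proof.
by exists (mpoly.mpolyC _ a) => g; rewrite mpoly.map_mpolyC mpoly.mevalC.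
Qed.

Lemma ratpoly_entry i j : ratpoly (fun g => g i j).
Proof.
exists (mpoly.mpolyX rat (mpoly.mnm1 (mxvec_index i j))) => g.
by rewrite mpoly.map_mpolyX mpoly.mevalXU mxvecE.
Qed.

Lemma ratpolyD f h : ratpoly f -> ratpoly h -> ratpoly (fun g => f g + h g).
Proof.
move=> [P fP] [Q hQ]; exists (P + Q) => g.
by rewrite fP hQ rmorphD mpoly.mevalD.
Qed.

Lemma ratpolyM f h : ratpoly f -> ratpoly h -> ratpoly (fun g => f g * h g).
Proof.
move=> [P fP] [Q hQ]; exists (P * Q) => g.
by rewrite fP hQ rmorphM mpoly.mevalM.
Qed.

Lemma ratpoly_conj f g : ratpoly f -> (f (map_mx Num.conj g))^* = f g.
Proof.
move=> [P fP]; rewrite !fP !mpoly.mevalE rmorph_sum; apply: eq_bigr => m _.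
rewrite rmorphM rmorph_prod mpoly.mcoeff_map_mpoly fmorph_rat; congr (_ * _).
apply: eq_bigr => i _; rewrite rmorphXn; congr (_ ^+ _).
by case/mxvec_indexP: i => i j; rewrite !mxvecE mxE; apply: conjCK.
Qed.

Variable d : rat.
Hypotheses (dl_conj : dl^* = - dl) (dl2 : dl ^+ 2 = ratr d) (dl0 : dl != 0).

Definition inK (x : C) := exists a b : rat, x = ratr a + dl * ratr b.

(** A polynomial with coefficients in Q(dl), kept as a pair of rational polynomials so that descent
    can treat the two parts separately. *)
Definition kpoly f := exists f1 f2, [/\ ratpoly f1, ratpoly f2
  & forall g, f g = f1 g + dl * f2 g].

Lemma kpolyC c : inK c -> kpoly (fun _ => c).
Proof.
move=> [a [b ->]]; exists (fun _ => ratr a), (fun _ => ratr b).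
by split=> //; apply: ratpolyC.
Qed.

Lemma kpoly_entry i j : kpoly (fun g => g i j).
Proof.
exists (fun g => g i j), (fun _ => ratr 0); split; first exact: ratpoly_entry.
  exact: ratpolyC.
by move=> g; rewrite rmorph0 mulr0 addr0.
Qed.

Lemma kpolyD f h : kpoly f -> kpoly h -> kpoly (fun g => f g + h g).
Proof.
move=> [f1 [f2 [pf1 pf2 fE]]] [h1 [h2 [ph1 ph2 hE]]].
exists (fun g => f1 g + h1 g), (fun g => f2 g + h2 g).
by split; try exact: ratpolyD; move=> g; rewrite fE hE; ring.
Qed.

Lemma kpolyM f h : kpoly f -> kpoly h -> kpoly (fun g => f g * h g).
Proof.
move=> [f1 [f2 [pf1 pf2 fE]]] [h1 [h2 [ph1 ph2 hE]]].
exists (fun g => f1 g * h1 g + ratr d * (f2 g * h2 g)),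
  (fun g => f1 g * h2 g + f2 g * h1 g); split.
- by apply: ratpolyD; [|apply: ratpolyM; [apply: ratpolyC|]]; apply: ratpolyM.
- by apply: ratpolyD; apply: ratpolyM.
- by move=> g; rewrite fE hE -dl2; ring.
Qed.

Lemma inKN1 : inK (-1).
Proof. by exists (-1), 0; rewrite rmorph0 mulr0 addr0 rmorphN1. Qed.

Lemma kpolyB f h : kpoly f -> kpoly h -> kpoly (fun g => f g - h g).
Proof.
move=> kf /(kpolyM (kpolyC inKN1))/(kpolyD kf) [f1 [f2 [p1 p2 E]]].
by exists f1, f2; split=> // g; rewrite -E mulN1r.
Qed.

Lemma kpoly_sum (I : finType) (F : I -> 'M[C]_N -> C) :
  (forall i, kpoly (F i)) -> kpoly (fun g => \sum_i F i g).
Proof.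
move=> kF; pose s := index_enum I.
suff: kpoly (fun g => \sum_(i <- s) F i g) by [].
elim: s => [|i s [f1 [f2 [p1 p2 E]]]].
  have [f1 [f2 [p1 p2 E]]] := kpolyB (kpolyC inKN1) (kpolyC inKN1).
  by exists f1, f2; split=> // g; rewrite -E subrr big_nil.
have [h1 [h2 [q1 q2 E']]] := kpolyD (kF i) (ex_intro _ _ (ex_intro _ _ (And3 p1 p2 E))).
by exists h1, h2; split=> // g; rewrite -E' big_cons.
Qed.

Lemma kpoly_mulmx (e : 'M[C]_N) i j : (forall k l, inK (e k l)) ->
  kpoly (fun g => (g *m e) i j).
Proof.
move=> Ke.
have [f1 [f2 [p1 p2 E]]] := kpoly_sum (fun k => kpolyM (kpoly_entry i k) (kpolyC (Ke k j))).
by exists f1, f2; split=> // g; rewrite -E mxE.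
Qed.

(* A relation over Q(dl) satisfied by a conjugation-stable set splits into two
   rational relations: this is Galois descent for Q(dl)/Q. *)
Lemma kpoly_descent (S : set 'M[C]_N) f g :
  (forall t, S t -> S (map_mx Num.conj t)) -> kpoly f ->
  (forall t, S t -> f t = 0) ->
  (forall h, ratpoly h -> (forall t, S t -> h t = 0) -> h g = 0) -> f g = 0.
Proof.
move=> Sc [f1 [f2 [p1 p2 E]]] f0 gz.
have two : (2 : C) != 0 by rewrite pnatr_eq0.
have f12 t : S t -> f1 t = 0 /\ f2 t = 0.
  move=> St; have e1 : f1 t + dl * f2 t = 0 by rewrite -E f0.
  (* Since conj dl = - dl, the left-hand side is the conjugate of the value of f at conj t, a point
     of S. *)
  have e2 : f1 t - dl * f2 t = 0.
    rewrite -(ratpoly_conj t p1) -(ratpoly_conj t p2).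
    have <- : (f (map_mx Num.conj t))^* = 0 by rewrite f0 ?rmorph0 //; apply: Sc.
    by rewrite E -mulNr -dl_conj rmorphD rmorphM.
  split.
    by apply: (mulfI two); rewrite mulr0 -[RHS]addr0 -{1}e1 -e2; ring.
  apply: (mulfI two); apply: (mulfI dl0).
  by rewrite !mulr0 -[RHS]subr0 -{1}e1 -e2; ring.
by rewrite E (gz _ p1) ?(gz _ p2) ?mulr0 ?addr0 // => t /f12 [].
Qed.

End RationalFunctions.

Section RegularFunctions.
Variables (C : fieldType) (n : nat).
Implicit Types (f h : ('I_n -> C) -> C).

Definition cpoly f := exists P : mpoly.mpoly n C, forall v, f v = mpoly.meval v P.

Lemma cpolyC c : cpoly (fun _ => c).
Proof. by exists (mpoly.mpolyC _ c) => v; rewrite mpoly.mevalC. Qed.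

Lemma cpoly_var i : cpoly (fun v => v i).
Proof. by exists (mpoly.mpolyX C (mpoly.mnm1 i)) => v; rewrite mpoly.mevalXU. Qed.

Lemma cpolyD f h : cpoly f -> cpoly h -> cpoly (fun g => f g + h g).
Proof.
by move=> [P fP] [Q hQ]; exists (P + Q) => g; rewrite fP hQ mpoly.mevalD.
Qed.

Lemma cpolyM f h : cpoly f -> cpoly h -> cpoly (fun g => f g * h g).
Proof.
by move=> [P fP] [Q hQ]; exists (P * Q) => g; rewrite fP hQ mpoly.mevalM.
Qed.

Lemma cpoly_ext f h : (forall v, f v = h v) -> cpoly h -> cpoly f.
Proof. by move=> E [P hP]; exists P => v; rewrite E. Qed.

Lemma cpoly_sum (I : finType) (F : I -> ('I_n -> C) -> C) :
  (forall i, cpoly (F i)) -> cpoly (fun g => \sum_i F i g).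
Proof.
move=> kF; pose s := index_enum I.
suff: cpoly (fun g => \sum_(i <- s) F i g) by [].
elim: s => [|i s IH].
  by apply: cpoly_ext (cpolyC 0) => v; rewrite big_nil.
by apply: cpoly_ext (cpolyD (kF i) IH) => v; rewrite big_cons.
Qed.

Lemma cpoly_prod (I : finType) (F : I -> ('I_n -> C) -> C) :
  (forall i, cpoly (F i)) -> cpoly (fun g => \prod_i F i g).
Proof.
move=> kF; pose s := index_enum I.
suff: cpoly (fun g => \prod_(i <- s) F i g) by [].
elim: s => [|i s IH].
  by apply: cpoly_ext (cpolyC 1) => v; rewrite big_nil.
by apply: cpoly_ext (cpolyM (kF i) IH) => v; rewrite big_cons.
Qed.

Lemma cpolyX f k : cpoly f -> cpoly (fun g => f g ^+ k).
Proof.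
move=> cf; elim: k => [|k IH]; first by apply: cpoly_ext (cpolyC 1).
by apply: cpoly_ext (cpolyM cf IH) => v; rewrite exprS.
Qed.

Lemma cpoly_det m (A : ('I_n -> C) -> 'M[C]_m) :
  (forall i j, cpoly (fun v => A v i j)) -> cpoly (fun v => \det (A v)).
Proof.
move=> cA; apply: cpoly_sum => s.
by apply: cpolyM; [apply: cpolyC|apply: cpoly_prod].
Qed.

Lemma cpoly_adj m (A : ('I_n -> C) -> 'M[C]_m) i j :
  (forall i j, cpoly (fun v => A v i j)) -> cpoly (fun v => (\adj (A v)) i j).
Proof.
move=> cA; apply: (@cpoly_ext _ (fun v => cofactor (A v) j i)).
  by move=> v; rewrite mxE.
apply: cpolyM; first exact: cpolyC.
apply: cpoly_det => k l.
by apply: (@cpoly_ext _ (fun v => A v (lift j k) (lift i l))) => // v; rewrite !mxE.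
Qed.

End RegularFunctions.

(** Pulls an equation back to a parametrised rational curve, where infinitely many roots force it to
    vanish. *)
Lemma meval_poly (C : fieldType) n (X : 'I_n -> {poly C}) (P : mpoly.mpoly n C) :
  exists p : {poly C}, forall r, mpoly.meval (fun i => (X i).[r]) P = p.[r].
Proof.
exists (\sum_(m <- mpoly.msupp P) (mpoly.mcoeff m P)%:P *
   \prod_i X i ^+ (mpoly.fun_of_multinom m i)) => r.
rewrite mpoly.mevalE horner_sum; apply: eq_bigr => m _.
rewrite hornerM hornerC horner_prod; congr (_ * _); apply: eq_bigr => i _.
by rewrite horner_exp.
Qed.

Lemma poly_eq0_infinite (C : fieldType) (p : {poly C}) (h : nat -> C) :
  injective h -> (forall k, root p (h k)) -> p = 0.
Proof.
move=> hi hr; apply/eqP/negPn/negP => p0.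
have := @max_poly_roots _ p (map h (iota 0 (size p))) p0.
rewrite size_map size_iota ltnn map_inj_uniq ?iota_uniq // => H.
suff: false by []; apply: H => //.
by apply/allP => _ /mapP[k _ ->].
Qed.

(** * The torus attached to four orthogonal projectors *)

Section Torus.
Variables (C : numClosedFieldType) (N : nat) (e : 'I_4 -> 'M[C]_N).
Hypothesis e_mul : forall p q, e p *m e q = if p == q then e p else 0.
Hypothesis e_sum : \sum_p e p = 1%:M.
Hypothesis e_neq0 : forall p, e p != 0.

(* The action on H^{3-p,p} is by u r^p; h(z) is the case u = z^3, r = conj z / z. *)
Definition torus_elt (u r : C) : 'M[C]_N := \sum_(p < 4) (u * r ^+ p) *: e p.

Definition hodge_torus : set 'M[C]_N :=
  [set g | exists u r, [/\ u != 0, r != 0 & g = torus_elt u r]].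

Lemma torus_elt_proj u r p : torus_elt u r *m e p = (u * r ^+ p) *: e p.
Proof.
rewrite mulmx_suml (bigD1 p) //= -scalemxAl e_mul eqxx big1 ?addr0 // => q /negPf qp.
by rewrite -scalemxAl e_mul qp scaler0.
Qed.

Lemma mulmx_proj_eq (g h : 'M[C]_N) : (forall p, g *m e p = h *m e p) -> g = h.
Proof.
move=> gh; rewrite -[g]mulmx1 -[h]mulmx1 -e_sum !mulmx_sumr.
by apply: eq_bigr => p _; rewrite gh.
Qed.

Lemma torus_eltM u r u' r' :
  torus_elt u r *m torus_elt u' r' = torus_elt (u * u') (r * r').
Proof.
apply: mulmx_proj_eq => p.
rewrite -mulmxA !torus_elt_proj -scalemxAr torus_elt_proj scalerA exprMn.
by congr (_ *: _); ring.
Qed.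

Lemma torus_elt1 : torus_elt 1 1 = 1%:M.
Proof. by rewrite -e_sum; apply: eq_bigr => p _; rewrite expr1n mulr1 scale1r. Qed.

Lemma torus_eltV u r : u != 0 -> r != 0 ->
  torus_elt u r \in unitmx /\ invmx (torus_elt u r) = torus_elt u^-1 r^-1.
Proof.
move=> u0 r0; have E : torus_elt u r *m torus_elt u^-1 r^-1 = 1%:M.
  by rewrite torus_eltM !divff // torus_elt1.
have [gu _] := mulmx1_unit E; split=> //.
by rewrite -[LHS]mulmx1 -E mulmxA mulVmx // mul1mx.
Qed.

Lemma hodge_torus_subgroup : subgroupGL hodge_torus.
Proof.
split.
- by move=> _ [u [r [u0 r0 ->]]]; have [] := torus_eltV u0 r0.
- by exists 1, 1; rewrite torus_elt1 oner_eq0.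
- move=> _ _ [u [r [u0 r0 ->]]] [u' [r' [u'0 r'0 ->]]].
  by exists (u * u'), (r * r'); rewrite !mulf_neq0 // torus_eltM.
- move=> _ [u [r [u0 r0 ->]]]; have [_ ->] := torus_eltV u0 r0.
  by exists u^-1, r^-1; rewrite !invr_eq0.
Qed.

Let ip p : {ij : 'I_N * 'I_N | e p ij.1 ij.2 != 0}.
Proof.
apply: sigW; apply: contrapT => H; case/negP: (e_neq0 p).
apply/eqP/matrixP => i j; rewrite mxE; apply/eqP/negPn/negP => H'.
by apply: H; exists (i, j).
Qed.

(** The scalar by which a torus element acts on the image of [e p], read off at a fixed nonzero
    entry of [e p]. It is thus a linear function on all matrices g. *)
Definition torus_coef (p : 'I_4) (g : 'M[C]_N) : C :=
  (g *m e p) (sval (ip p)).1 (sval (ip p)).2 / e p (sval (ip p)).1 (sval (ip p)).2.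

Lemma torus_coef_elt p u r : torus_coef p (torus_elt u r) = u * r ^+ p.
Proof.
by rewrite /torus_coef torus_elt_proj mxE mulfK //; apply: (svalP (ip p)).
Qed.

Section Rationality.
Variables (dl : C) (d : rat).
Hypotheses (dl_conj : dl^* = - dl) (dl2 : dl ^+ 2 = ratr d) (dl0 : dl != 0).
Hypothesis e_conj : forall p, map_mx Num.conj (e p) = e (rev_ord p).
Hypothesis e_inK : forall p i j, inK dl (e p i j).

(** Conjugation exchanges [e p] and [e (3 - p)], so the new scalar at p is the conjugate of u
    r^(3-p) = (u r^3) (r^-1)^p. *)
Lemma hodge_torus_conj t : hodge_torus t -> hodge_torus (map_mx Num.conj t).
Proof.
case=> u [r [u0 r0 ->]]; exists (u * r ^+ 3)^*, (r^-1)^*.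
have ur0 : u * r ^+ 3 != 0 by rewrite mulf_neq0 // expf_neq0.
rewrite !fmorph_eq0 invr_eq0 ur0 r0; split=> //.
rewrite /torus_elt (reindex_inj rev_ord_inj) /= map_mx_sum.
apply: eq_bigr => p _; rewrite map_mxZ e_conj rev_ordK; congr (_ *: _).
rewrite -rmorphXn -rmorphM; congr (_^*).
have -> : r ^+ 3 = r ^+ rev_ord p * r ^+ p by rewrite -exprD /= subSS subnK // leq_ord.
by rewrite -!mulrA -exprMn divff // expr1n mulr1.
Qed.

(** Equations over Q(dl) for the torus say that g acts on each [e p] by a scalar a_p and that these
    scalars satisfy quadratic relations. By descent they hold at g as soon as all rational equations
    of the torus do. *)
Lemma hodge_torus_zariski g : g \in unitmx ->
  (forall h, ratpoly h -> (forall t, hodge_torus t -> h t = 0) -> h g = 0) ->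
  hodge_torus g.
Proof.
move=> gu gz.
have kz f : kpoly dl f -> (forall t, hodge_torus t -> f t = 0) -> f g = 0.
  move=> kf f0; exact: (kpoly_descent dl_conj dl0 hodge_torus_conj kf f0 gz).
have kM p i j : kpoly dl (fun g => (g *m e p) i j) by apply: (kpoly_mulmx dl2 _ _ (e_inK p)).
have kE p i j : kpoly dl (fun _ : 'M[C]_N => e p i j) by apply: kpolyC.
pose a p := torus_coef p g.
have ae p : g *m e p = a p *: e p.
  apply/matrixP => i j; rewrite [RHS]mxE /a /torus_coef.
  set k := (sval (ip p)).1; set l := (sval (ip p)).2.
  have ekl : e p k l != 0 := svalP (ip p).
  apply: (mulIf ekl); rewrite mulrAC divfK //; apply: subr0_eq.
  have := kz _ (kpolyB dl2 (kpolyM dl2 (kM p i j) (kE p k l)) (kpolyM dl2 (kM p k l) (kE p i j))).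
  apply => t [u [r [_ _ ->]]]; rewrite torus_elt_proj !mxE; ring.
have a0 p : a p != 0.
  apply/eqP => ap; case/negP: (e_neq0 p); apply/eqP.
  by rewrite -[LHS](mulKmx gu) ae ap scale0r mulmx0.
(* These are equations of the cone over the twisted cubic (u, u r, u r^2, u r^3). Multiplying by
   entries of the projectors clears the denominators of [torus_coef]. *)
have quad (p q s : 'I_4) : (p + q = s + s)%N -> a p * a q = a s * a s.
  move=> pqs; rewrite /a /torus_coef.
  move: (svalP (ip p)) (svalP (ip q)) (svalP (ip s)).
  set i := (sval (ip p)).1; set j := (sval (ip p)).2.
  set k := (sval (ip q)).1; set l := (sval (ip q)).2.
  set m := (sval (ip s)).1; set n := (sval (ip s)).2 => e1 e2 e3.
  have /kz E := kpolyB dl2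
     (kpolyM dl2 (kpolyM dl2 (kM p i j) (kM q k l)) (kpolyM dl2 (kE s m n) (kE s m n)))
     (kpolyM dl2 (kpolyM dl2 (kM s m n) (kM s m n)) (kpolyM dl2 (kE p i j) (kE q k l))).
  have {}E : (g *m e p) i j * (g *m e q) k l * (e s m n * e s m n)
      - (g *m e s) m n * (g *m e s) m n * (e p i j * e q k l) = 0.
    apply: E => t [u [r [_ _ ->]]]; rewrite !torus_elt_proj !mxE.
    transitivity (u ^+ 2 * (r ^+ (p + q) - r ^+ (s + s))
      * e p i j * e q k l * e s m n ^+ 2).
      by rewrite !exprD; ring.
    by rewrite pqs subrr; ring.
  apply: (mulIf e1); apply: (mulIf e2); apply: (mulIf e3); apply: (mulIf e3).
  apply: subr0_eq; rewrite -[RHS]E.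
  by field; rewrite e1 e2 e3.
(* As no a_p vanishes, a_0 a_2 = a_1^2 and a_1 a_3 = a_2^2 determine a_2 and a_3 from a_0 = u and
   a_1 = u r. *)
clearbody a; exists (a 0), (a 1 / a 0); split=> //.
  by rewrite mulf_neq0 ?invr_eq0 ?a0.
apply: mulmx_proj_eq => p; rewrite torus_elt_proj ae; congr (_ *: _).
have a00 := a0 0; have a10 := a0 1.
have a2 : a 2 = a 1 ^+ 2 / a 0.
  by apply: (mulfI a00); rewrite (quad 0 2 1) //; field.
have a3 : a 3 = a 1 ^+ 3 / a 0 ^+ 2.
  by apply: (mulfI a10); rewrite (quad 1 3 2) // a2; field.
have [E|[E|[E|E]]] : p = 0 \/ p = 1 \/ p = 2 \/ p = 3.
  case: p => [[|[|[|[|//]]]] Hp]; [left|right;left|do 2 right;left|do 3 right];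
  exact/val_inj.
- by rewrite E expr0 mulr1.
- by rewrite E expr1; field.
- by rewrite E a2; field.
- by rewrite E a3; field.
Qed.

Lemma hodge_torus_Qalg : Qalg_subgroup hodge_torus.
Proof.
split; first exact: hodge_torus_subgroup.
exists [set P | forall t, hodge_torus t ->
  mpoly.meval (mxvec t 0) (mpoly.map_mpoly (ratr : rat -> C) P) = 0].
apply/seteqP; split=> g.
  move=> tg; split=> [|P]; last by apply.
  by have [h _ _ _] := hodge_torus_subgroup; apply: h.
move=> [gu gz]; apply: hodge_torus_zariski => // h [P hP] h0.
by rewrite hP; apply: gz => t /h0; rewrite hP.
Qed.

End Rationality.

(** * Density of h in the torus, and algebraic coordinates on the torus *)

Lemma Qalg_subgroup_curve (H : set 'M[C]_N) (X : 'I_N -> 'I_N -> {poly C})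
    (h : nat -> C) r :
  Qalg_subgroup H -> injective h ->
  (forall k, H (\matrix_(i, j) (X i j).[h k])) ->
  (\matrix_(i, j) (X i j).[r]) \in unitmx -> H (\matrix_(i, j) (X i j).[r]).
Proof.
move=> [_ [E HE]] hi Hh ru; rewrite HE; split=> // P EP.
pose Y (i : 'I_(N * N)) := mxvec (\matrix_(i, j) X i j) 0 i.
have YE s i : (Y i).[s] = mxvec (\matrix_(i, j) (X i j).[s]) 0 i.
  by rewrite /Y; case/mxvec_indexP: i => i j; rewrite !mxvecE !mxE.
set Q := mpoly.map_mpoly _ P; have [p pE] := meval_poly Y Q.
have evE s : mpoly.meval (mxvec (\matrix_(i, j) (X i j).[s]) 0) Q = p.[s].
  by rewrite -pE; apply/esym/mpoly.meval_eq.
rewrite evE (@poly_eq0_infinite _ p _ hi) ?horner0 // => k.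
by apply/eqP; rewrite -evE; have := Hh k; rewrite HE => -[_]; apply.
Qed.

(* A rational equation satisfied at infinitely many points of a rational curve
   holds on the whole curve.  This is applied to the scalars, where h(k+1) is
   (k+1)^3, and then to r |-> torus_elt 1 r at the points r = conj z / z with
   z = 1 + i k. *)
Lemma hodge_torus_min (H : set 'M[C]_N) : Qalg_subgroup H ->
  (forall z, z != 0 -> H (torus_elt (z ^+ 3) (z^* / z))) -> hodge_torus `<=` H.
Proof.
move=> QH Hz; have [[Hu H1 HM HV] _] := QH.
have scal g s : H g -> s != 0 -> H (s *: g).
  move=> Hg s0.
  have E s' : s' *: g = \matrix_(i, j) ('X * (g i j)%:P).[s'].
    by apply/matrixP => i j; rewrite !mxE hornerM hornerX hornerC.
  rewrite E; apply: (@Qalg_subgroup_curve _ (fun i j => 'X * (g i j)%:P)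
    (fun k => k.+1%:R ^+ 3) s QH).
  - by move=> k l /eqP; rewrite -!natrX eqr_nat eqn_exp2r // => /eqP[].
  - move=> k; rewrite -E; have k0 : k.+1%:R != 0 :> C by rewrite pnatr_eq0.
    have := HM _ _ (Hz _ k0) Hg; rewrite conjC_nat divff //.
    rewrite /torus_elt; under eq_bigr => p _ do rewrite expr1n mulr1.
    by rewrite -scaler_sumr e_sum -scalemxAl mul1mx.
  - by rewrite -E unitmxZ ?unitfE //; apply: Hu.
move=> _ [u [r [u0 r0 ->]]].
have uE x y : torus_elt (x * y) r = x *: torus_elt y r.
  by rewrite /torus_elt scaler_sumr; apply: eq_bigr => p _; rewrite scalerA mulrA.
rewrite -[u]mulr1 uE; apply: (scal _ _ _ u0).
have E s : torus_elt 1 s = \matrix_(i, j) (\sum_(p < 4) 'X^p * (e p i j)%:P).[s].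
  apply/matrixP => i j; rewrite !mxE horner_sum summxE; apply: eq_bigr => p _.
  by rewrite hornerM hornerXn hornerC mxE mul1r.
have zk0 k : 1 + 'i * k%:R != 0 :> C.
  apply/eqP => /(congr1 (fun z => 'Re z)).
  by rewrite raddf0 Re_rect ?rpred1 ?rpred_nat // => /eqP; rewrite oner_eq0.
pose h k : C := (1 + 'i * k%:R)^* / (1 + 'i * k%:R).
have hi : injective h.
  move=> k l; rewrite /h !rmorphD !rmorphM /= conjCi !conjC_nat rmorph1 => /eqP.
  rewrite eqr_div // => /eqP E'.
  have : 2 * 'i * (k%:R - l%:R) = 0 :> C.
    transitivity ((1 + - 'i * l%:R) * (1 + 'i * k%:R) - (1 + - 'i * k%:R) * (1 + 'i * l%:R) : C).
      by ring.
    by rewrite E' subrr.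
  move/eqP; rewrite !mulf_eq0 pnatr_eq0 (negPf (neq0Ci _)) /= subr_eq0 eqr_nat.
  by move/eqP.
rewrite E; apply: (Qalg_subgroup_curve QH hi) => [k|]; rewrite -E; last first.
  by have [] := @torus_eltV 1 r (oner_neq0 _) r0.
(* Scaling h(z) by z^-3, which [scal] permits, leaves [torus_elt 1 (h k)]. *)
have z0 := zk0 k; have z3 : (1 + 'i * k%:R) ^- 3 != 0 :> C.
  by rewrite invr_eq0 expf_neq0.
have := scal _ _ (Hz _ z0) z3.
rewrite /torus_elt scaler_sumr; congr H; apply: eq_bigr => p _.
by rewrite scalerA mulrA mulVf ?expf_neq0.
Qed.

Lemma cpoly_torus_coef n p (B : ('I_n -> C) -> 'M[C]_N) :
  (forall i j, cpoly (fun v => B v i j)) -> cpoly (fun v => torus_coef p (B v)).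
Proof.
move=> cB; apply: cpolyM; last exact: cpolyC.
apply: (@cpoly_ext _ _ _ (fun v => \sum_k B v _ k * e p k _)) => [v|].
  by rewrite mxE.
by apply: cpoly_sum => k; apply: cpolyM => //; apply: cpolyC.
Qed.

Lemma diag_torus2 (t : 'M[C]_2) : diag_torus t <->
  [/\ t 0 0 != 0, t 1 1 != 0, t 0 1 = 0 & t 1 0 = 0].
Proof.
have dE : is_diag_mx t -> \det t = t 0 0 * t 1 1.
  move=> td; rewrite det_trig; last exact: is_diag_mx_is_trig.
  by rewrite !big_ord_recl big_ord0 mulr1; congr (_ * t _ _); apply: val_inj.
split=> [[td]|[t0 t1 t01 t10]].
  rewrite unitmxE unitfE dE // mulf_eq0 negb_or => /andP[? ?].
  by split=> //; move/is_diag_mxP: td; apply.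
have td : is_diag_mx t.
  apply/is_diag_mxP => i j.
  have ord2 (k : 'I_2) : k = 0 \/ k = 1.
    by case: k => [[|[|//]] Hk]; [left|right]; apply: val_inj.
  by case: (ord2 i) => ->; case: (ord2 j) => ->.
by split=> //; rewrite unitmxE unitfE dE // mulf_neq0.
Qed.

(** The coordinates are u = a_0(g) and r = a_1(g) a_0(g^-1). Taking the coefficient of the inverse
    instead of dividing by a_0(g) makes r visibly polynomial in the entries of g and det(g)^-1. *)
Lemma hodge_torus_is_torus : is_torus hodge_torus.
Proof.
pose coord (g : 'M[C]_N) : 'M[C]_2 := \matrix_(i < 2, j < 2)
  (if i == j then (if i == 0 then torus_coef 0 g
    else torus_coef 1 g * torus_coef 0 (invmx g)) else 0).
have coordE u r : u != 0 -> r != 0 -> [/\ coord (torus_elt u r) 0 0 = u,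
    coord (torus_elt u r) 1 1 = r, coord (torus_elt u r) 0 1 = 0
    & coord (torus_elt u r) 1 0 = 0].
  move=> u0 r0; rewrite !mxE /=; have [_ ->] := torus_eltV u0 r0.
  by rewrite !torus_coef_elt !expr0 !mulr1 expr1 mulrAC divff // mul1r.
exists 2%N, (fun t => torus_elt (t 0 0) (t 1 1)), coord; split.
- split=> i j.
    pose ent k l : 'I_(2 * 2 + 1) := lshift 1 (mxvec_index k l).
    have [P HP] : cpoly (fun v => \sum_(p < 4) v (ent 0 0) * v (ent 1 1) ^+ p * e p i j).
      apply: cpoly_sum => p; apply: cpolyM; last exact: cpolyC.
      by apply: cpolyM; [|apply: cpolyX]; apply: cpoly_var.
    exists P => t _; rewrite -HP !row_mxEl !mxvecE summxE.
    by apply: eq_bigr => p _; rewrite mxE.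
  (* The last coordinate [D] of v stands for det(g)^-1, so that [D v *: \adj (A v)] stands for the
     inverse of g. *)
  pose A (v : 'I_(N * N + 1) -> C) : 'M[C]_N := \matrix_(k, l) v (lshift 1 (mxvec_index k l)).
  pose D (v : 'I_(N * N + 1) -> C) : C := v (rshift _ 0).
  have cA k l : cpoly (fun v => A v k l).
    apply: (@cpoly_ext _ _ _ (fun v => v (lshift 1 (mxvec_index k l)))) => [v|].
      by rewrite mxE.
    exact: cpoly_var.
  have cI k l : cpoly (fun v => (D v *: \adj (A v)) k l).
    apply: (@cpoly_ext _ _ _ (fun v => D v * (\adj (A v)) k l)) => [v|].
      by rewrite mxE.
    by apply: cpolyM; [apply: cpoly_var|apply: cpoly_adj].
  have [P HP] : cpoly (fun v => if i == j then (if i == 0 then torus_coef 0 (A v)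
      else torus_coef 1 (A v) * torus_coef 0 (D v *: \adj (A v))) else 0).
    case: (i == j); last exact: cpolyC.
    case: (i == 0); first exact: cpoly_torus_coef.
    by apply: cpolyM; apply: cpoly_torus_coef.
  exists P => g Hg; rewrite -HP.
  have gu : g \in unitmx by have [h _ _ _] := hodge_torus_subgroup; apply: h.
  set v := row_mx _ _ 0.
  have -> : A v = g by apply/matrixP => k l; rewrite mxE /v row_mxEl mxvecE.
  have -> : D v = (\det g)^-1 by rewrite /D /v row_mxEr mxE eqxx.
  by rewrite mxE /invmx gu.
- move=> t /diag_torus2[t0 t1 t01 t10].
  have [c0 c1 c01 c10] := coordE _ _ t0 t1; split; first by exists (t 0 0), (t 1 1).
  apply/matrixP => i j.
  have ord2 (k : 'I_2) : k = 0 \/ k = 1.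
    by case: k => [[|[|//]] Hk]; [left|right]; apply: val_inj.
  by case: (ord2 i) => ->; case: (ord2 j) => ->; rewrite ?t01 ?t10.
- move=> _ [u [r [u0 r0 ->]]]; have [c0 c1 c01 c10] := coordE _ _ u0 r0.
  by split; [apply/diag_torus2; rewrite c0 c1 | rewrite c0 c1].
- move=> t u /diag_torus2[t0 t1 t01 t10] /diag_torus2[u0 u1 u01 u10].
  rewrite torus_eltM; congr torus_elt; rewrite mxE !big_ord_recl big_ord0 addr0.
    by rewrite [lift _ _](_ : _ = 1) ?t01 ?mul0r ?addr0 //; apply: val_inj.
  by rewrite [lift _ _](_ : _ = 1) ?t10 ?mul0r ?add0r //; apply: val_inj.
Qed.

End Torus.

(** * Hodge decompositions and the Mumford-Tate group *)

Section QuadraticField.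
Variables (C : numClosedFieldType) (dl : C) (d : rat).
Hypotheses (dl_conj : dl^* = - dl) (dl2 : dl ^+ 2 = ratr d) (dl0 : dl != 0).

Lemma inK_rat a : inK dl (ratr a).
Proof. by exists a, 0; rewrite rmorph0 mulr0 addr0. Qed.

Lemma inKD x y : inK dl x -> inK dl y -> inK dl (x + y).
Proof.
move=> [a [b ->]] [a' [b' ->]]; exists (a + a'), (b + b').
by rewrite !rmorphD; ring.
Qed.

Lemma inKM x y : inK dl x -> inK dl y -> inK dl (x * y).
Proof.
move=> [a [b ->]] [a' [b' ->]]; exists (a * a' + d * (b * b')), (a * b' + b * a').
by rewrite !(rmorphD, rmorphM) /= -dl2; ring.
Qed.

Lemma inK_conj x : inK dl x -> inK dl x^*.
Proof.
move=> [a [b ->]]; exists a, (- b).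
by rewrite rmorphD rmorphM /= dl_conj !fmorph_rat rmorphN; ring.
Qed.

Lemma inKV : inK dl dl^-1.
Proof.
exists 0, d^-1; rewrite rmorph0 add0r fmorphV /= -dl2 expr2 invfM mulrA divff // mul1r //.
Qed.

Definition inKmx m n (A : 'M[C]_(m, n)) := forall i j, inK dl (A i j).

Lemma inKmx_rat m n (A : 'M[rat]_(m, n)) : inKmx (map_mx ratr A).
Proof. by move=> i j; rewrite mxE; apply: inK_rat. Qed.

Lemma inKmxD m n (A B : 'M[C]_(m, n)) : inKmx A -> inKmx B -> inKmx (A + B).
Proof. by move=> KA KB i j; rewrite mxE; apply: inKD. Qed.

Lemma inKmxZ m n a (A : 'M[C]_(m, n)) : inK dl a -> inKmx A -> inKmx (a *: A).
Proof. by move=> Ka KA i j; rewrite mxE; apply: inKM. Qed.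

Lemma inKmxN m n (A : 'M[C]_(m, n)) : inKmx A -> inKmx (- A).
Proof.
rewrite -scaleN1r; apply: inKmxZ.
by rewrite -(rmorphN1 (ratr : rat -> C)); apply: inK_rat.
Qed.

Lemma inKmxM m n p (A : 'M[C]_(m, n)) (B : 'M[C]_(n, p)) :
  inKmx A -> inKmx B -> inKmx (A *m B).
Proof.
move=> KA KB i j; rewrite mxE; apply: (big_ind (inK dl)) => [|x y|k _].
- by rewrite -(rmorph0 (ratr : rat -> C)); apply: inK_rat.
- exact: inKD.
- exact: inKM.
Qed.

Lemma inKmx_conj m n (A : 'M[C]_(m, n)) : inKmx A -> inKmx (map_mx Num.conj A).
Proof. by move=> KA i j; rewrite mxE; apply: inK_conj. Qed.

Lemma inKmx_tr m n (A : 'M[C]_(m, n)) : inKmx A -> inKmx A^T.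
Proof. by move=> KA i j; rewrite mxE. Qed.

End QuadraticField.

Section HodgeDecomposition.
Variables (C : numClosedFieldType) (N : nat) (Fil : nat -> set 'rV[C]_N).
Hypothesis HS : hodge_structure 3 Fil.

Lemma conjVK (v : 'rV[C]_N) : conjV (conjV v) = v.
Proof. by apply/rowP => i; rewrite !mxE; apply: conjCK. Qed.

Lemma conjVD (v w : 'rV[C]_N) : conjV (v + w) = conjV v + conjV w.
Proof. by apply: map_mxD. Qed.

Lemma conjVZ a (v : 'rV[C]_N) : conjV (a *: v) = a^* *: conjV v.
Proof. by apply: map_mxZ. Qed.

Lemma conjVN (v : 'rV[C]_N) : conjV (- v) = - conjV v.
Proof. by apply: map_mxN. Qed.

Lemma hodge_comp_conj p q v : hodge_comp Fil p q v -> hodge_comp Fil q p (conjV v).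
Proof.
move=> [Fv [w Fw wv]]; split; first by rewrite -wv conjVK.
by exists v.
Qed.

Lemma filD p v w : Fil p v -> Fil p w -> Fil p (v + w).
Proof. by have [sub _ _ _] := HS; have [_ /(_ 1 v w)] := sub p; rewrite scale1r. Qed.

Lemma filN p v : Fil p v -> Fil p (- v).
Proof.
have [sub _ _ _] := HS; have [F0 /(_ (-1) v 0)] := sub p.
by rewrite scaleN1r addr0 => H Fv; apply: H.
Qed.

(** [hodge_structure] supplies the splittings of V into F^p and the conjugate of F^{4-p}. The one
    for p = 2 cuts V into F^2 and its conjugate; the one for p = 3 cuts F^2 into H^{3,0} and
    H^{2,1}, and conjugation treats the other half. *)
Lemma hodge_decomposition v : exists x : 'I_4 -> 'rV[C]_N,
  (forall p : 'I_4, hodge_comp Fil (3 - p) p (x p)) /\ v = \sum_p x p.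
Proof.
have [_ [F0 _] dec dsum] := HS.
have split2 u : Fil 2 u -> exists a b, [/\ hodge_comp Fil 3 0 a, hodge_comp Fil 2 1 b
    & u = a + b].
  move=> F2u; have [[a b] [/= [Fa [b' Fb' b'b] uE] _]] := dsum 3%N isT u.
  exists a, b; split=> //; split=> //.
  - by exists (conjV a); [rewrite F0|rewrite conjVK].
  - have -> : b = u - a by rewrite uE addrC addKr.
    by apply: filD => //; apply: filN; apply: dec.
  - by exists b'.
have [[f g] [/= [Ff [g' Fg' g'g] vE] _]] := dsum 2%N isT v.
have [a [b [Ha Hb fE]]] := split2 f Ff.
have [a' [b' [Ha' Hb' gE]]] := split2 g' Fg'.
exists (fun p => nth 0 [:: a; b; conjV b'; conjV a'] p); split.
  case=> [[|[|[|[|//]]]] Hp] //=.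
    exact: (hodge_comp_conj Hb').
  exact: (hodge_comp_conj Ha').
rewrite !big_ord_recl big_ord0 /= addr0 vE fE -g'g gE conjVD.
by rewrite -addrA [conjV a' + _]addrC.
Qed.

(** Such a v lies both in F^3 and in the conjugate of F^1, so 0 = v + (- v) is a decomposition for p
    = 3, and decompositions are unique. *)
Lemma fil3_real v : Fil 3 v -> conjV v = v -> v = 0.
Proof.
have [sub [F0 _] dec dsum] := HS => Fv vr.
have [ab [_ uniq]] := dsum 3%N isT 0.
have z p : Fil p 0 by have [] := sub p.
have E1 : ab = (0, 0).
  by apply: uniq; split; rewrite ?addr0 //; exists 0 => //; apply: map_mx0.
have : ab = (v, - v).
  apply: uniq; split; rewrite /= ?subrr //.
  exists (- v); last by rewrite conjVN vr.
  by apply: filN; do 2! apply: (dec _).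
by rewrite E1 => -[].
Qed.

Variable S : 'rV[C]_N -> 'rV[C]_N -> C.
Hypothesis S_add : forall v w u, S (v + w) u = S v u + S w u.
Hypothesis pol : polarized 3 Fil S.

(** Pairing x with the conjugate of one Hodge component of x isolates the Hermitian norm of that
    component, which is positive unless the component is 0. *)
Lemma polarized_nondegenerate x : (forall w, S x w = 0) -> x = 0.
Proof.
move=> x0; have [y [Hy xE]] := hodge_decomposition x.
have S0 u : S 0 u = 0 by have := S_add 0 0 u; rewrite addr0 -[LHS]addr0 => /addrI.
have S_sum (z : 'I_4 -> 'rV[C]_N) u : S (\sum_p z p) u = \sum_p S (z p) u.
  by apply: (big_morph (S^~ u)).
rewrite xE big1 // => p _; apply/eqP/negPn/negP => yp0.
have [orth pos] := pol.
have Hc (q : 'I_4) : hodge_comp Fil (3 - q) (3 - (3 - q)) (y q).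
  by rewrite subKn ?leq_ord //; apply: Hy.
have := pos (3 - p)%N (y p) (leq_subr _ _) (Hc p) yp0.
suff -> : S (y p) (conjV (y p)) = 0 by rewrite mulr0 ltxx.
rewrite -(x0 (conjV (y p))) xE S_sum (bigD1 p) //= big1 ?addr0 // => q qp.
apply: (orth (3 - q)%N p) => //; [exact: leq_subr|exact: leq_ord| |].
  move/eqP; rewrite -(eqn_add2r q) addnAC subnK ?leq_ord // eqn_add2l => /eqP E.
  by case/negP: qp; apply/eqP/val_inj.
exact: (hodge_comp_conj (Hy p)).
Qed.

End HodgeDecomposition.

Section Projectors.
Variables (C : numClosedFieldType) (N : nat) (Fil : nat -> set 'rV[C]_N).
Hypothesis HS : hodge_structure 3 Fil.
Variable e : 'I_4 -> 'M[C]_N.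
Hypothesis e_act : forall (p q : 'I_4) v, hodge_comp Fil (3 - p) p v ->
  v *m e q = if p == q then v else 0.

Lemma hodge_ext (g h : 'M[C]_N) :
  (forall (p : 'I_4) v, hodge_comp Fil (3 - p) p v -> v *m g = v *m h) -> g = h.
Proof.
move=> gh; apply/row_matrixP => i; rewrite !rowE.
have [x [Hx ->]] := hodge_decomposition HS (delta_mx 0 i).
by rewrite !mulmx_suml; apply: eq_bigr => p _; apply: (gh p).
Qed.

Lemma projector_mul p q : e p *m e q = if p == q then e p else 0.
Proof.
apply: hodge_ext => r v Hv; rewrite mulmxA (e_act _ Hv); case: (eqVneq r p) => [<-|rp].
  rewrite (e_act _ Hv); case: eqVneq => _; last by rewrite mulmx0.
  by rewrite (e_act _ Hv) eqxx.
by rewrite mul0mx; case: ifP => _; rewrite ?mulmx0 // (e_act _ Hv) (negPf rp).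
Qed.

Lemma projector_sum : \sum_p e p = 1%:M.
Proof.
apply: hodge_ext => r v Hv; rewrite mulmx1 mulmx_sumr (bigD1 r) //= (e_act _ Hv) eqxx.
by rewrite big1 ?addr0 // => q /negPf qr; rewrite (e_act _ Hv) eq_sym qr.
Qed.

(** The condition in [hodge_op] has exactly one solution because the Hodge components span V. *)
Lemma hodge_op_torus z : z != 0 ->
  hodge_op 3 Fil z = [set torus_elt e (z ^+ 3) (z^* / z)].
Proof.
move=> z0.
have act (p : 'I_4) v : hodge_comp Fil (3 - p) p v ->
    v *m torus_elt e (z ^+ 3) (z^* / z) = (z ^+ (3 - p) * z^* ^+ p) *: v.
  move=> Hv; rewrite mulmx_sumr (bigD1 p) //= -scalemxAr (e_act _ Hv) eqxx.
  rewrite big1 ?addr0 => [|q /negPf qp]; last first.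
    by rewrite -scalemxAr (e_act _ Hv) eq_sym qp scaler0.
  congr (_ *: _); rewrite expr_div_n -[X in z ^+ X](subnK (leq_ord p)) exprD.
  by field; rewrite expf_neq0.
apply/seteqP; split=> [g [gu gop]|_ ->].
  apply: hodge_ext => p v Hv; rewrite (act p) //.
  have := gop (3 - p)%N v (leq_subr _ _); rewrite subKn ?leq_ord //; exact.
split.
  have r0 : z^* / z != 0 by rewrite mulf_neq0 ?invr_eq0 ?fmorph_eq0.
  by have [] := torus_eltV projector_mul projector_sum (expf_neq0 3 z0) r0.
move=> p v p3 Hv; have lt : (3 - p < 4)%N by rewrite ltnS leq_subr.
have := act (Ordinal lt) v; rewrite /= subKn //; exact.
Qed.

Variables (dl : C) (d : rat).
Hypotheses (dl_conj : dl^* = - dl) (dl2 : dl ^+ 2 = ratr d) (dl0 : dl != 0).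
Hypothesis e_neq0 : forall p, e p != 0.
Hypothesis e_conj : forall p, map_mx Num.conj (e p) = e (rev_ord p).
Hypothesis e_inK : forall p, inKmx dl (e p).

Lemma mumford_tate_torus : is_torus (mumford_tate 3 Fil).
Proof.
have -> : mumford_tate 3 Fil = hodge_torus e.
  apply/seteqP; split=> g.
    apply; split.
      exact: (hodge_torus_Qalg projector_mul projector_sum e_neq0 dl_conj dl2 dl0
        e_conj e_inK).
    move=> z z0; rewrite hodge_op_torus // => _ ->.
    exists (z ^+ 3), (z^* / z); split=> //; first exact: expf_neq0.
    by rewrite mulf_neq0 ?invr_eq0 ?fmorph_eq0.
  move=> Tg H [QH HH]; apply: (hodge_torus_min projector_mul projector_sum QH _ Tg).
  by move=> z z0; apply: (HH z z0); rewrite hodge_op_torus.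
exact: (hodge_torus_is_torus projector_mul projector_sum e_neq0).
Qed.

End Projectors.

(** * Attractor points *)

Section Attractor.
Variables (C : numClosedFieldType) (J : jordan) (T : tens (Vdim J) 4).
Hypothesis I4T : forall (F : numFieldType) (v : 'rV[F]_(Vdim J)),
  I4 v = tev T (nseq 4 v).
Variables (om : 'rV[C]_(Vdim J)) (gam : 'rV[rat]_(Vdim J)) (c : C).
Hypothesis Oom : Ocone om.
Hypothesis HS : hodge_structure 3 (CYfil om).
Hypothesis pol : exists2 eps : C, eps = 1 \/ eps = -1 &
  polarized 3 (CYfil om) (fun v w => eps * symp v w).
Hypothesis Hgam : I4 gam != 0.

Let W := c *: om.
Let W' := conjV W.
Let gC : 'rV[C]_(Vdim J) := map_mx ratr gam.
Hypothesis gE : gC = W + W'.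

Let H p := hodge_comp (CYfil om) (3 - p) p.

Lemma symp_nondegenerate (x : 'rV[C]_(Vdim J)) : (forall w, symp x w = 0) -> x = 0.
Proof.
have [eps _ P] := pol => x0; apply: (polarized_nondegenerate HS _ P) => [v w u|w].
  by rewrite -{1}[v]scale1r symp_linear_l mul1r mulrDr.
by rewrite x0 mulr0.
Qed.

Lemma Vgram_unit : Vgram J C \in unitmx.
Proof.
rewrite -row_free_unit; apply: inj_row_free => v v0; apply: symp_nondegenerate => w.
by rewrite symp_gram v0 mul0mx mxE.
Qed.

Lemma symp_conj (v w : 'rV[C]_(Vdim J)) : symp (conjV v) (conjV w) = (symp v w)^*.
Proof. exact: (symp_map Num.conj). Qed.

Lemma sympZl a (v w : 'rV[C]_(Vdim J)) : symp (a *: v) w = a * symp v w.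
Proof.
have z : symp 0 w = 0.
  by have := symp_linear_l w (-1) 0 0; rewrite scaler0 addr0 mulN1r addNr.
by rewrite -[a *: v]addr0 symp_linear_l z addr0.
Qed.

Lemma sympBl (v v' w : 'rV[C]_(Vdim J)) : symp (v - v') w = symp v w - symp v' w.
Proof. by rewrite addrC -scaleN1r symp_linear_l mulN1r addrC. Qed.

Lemma symp_self (v : 'rV[C]_(Vdim J)) : symp v v = 0.
Proof.
apply: (@mulfI _ 2); first by rewrite pnatr_eq0.
by rewrite mulr0 mulr_natl mulr2n {1}symp_anti addNr.
Qed.

Lemma S4Zl a (x y z w : 'rV[C]_(Vdim J)) : S4 T (a *: x) y z w = a * S4 T x y z w.
Proof.
have z0 : S4 T 0 y z w = 0.
  by have := S4_linear T (-1) 0 0 y z w; rewrite scaler0 addr0 mulN1r addNr.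
by rewrite -[a *: x]addr0 S4_linear z0 addr0.
Qed.

Lemma S4Dl (x x' y z w : 'rV[C]_(Vdim J)) :
  S4 T (x + x') y z w = S4 T x y z w + S4 T x' y z w.
Proof. by rewrite -[x]scale1r S4_linear scale1r mul1r. Qed.

Lemma S4_conj (x y z w : 'rV[C]_(Vdim J)) :
  S4 T (conjV x) (conjV y) (conjV z) (conjV w) = (S4 T x y z w)^*.
Proof. exact: (S4_map T Num.conj). Qed.

Lemma S4_W v w : S4 T W W v w = - 4 * (symp W v * symp W w).
Proof. by rewrite /W S4Zl S4_C12 S4Zl (S4_cone I4T) // !sympZl; ring. Qed.

Lemma S4_W' v w : S4 T W' W' v w = - 4 * (symp W' v * symp W' w).
Proof.
rewrite -[v]conjVK -[w]conjVK S4_conj S4_W !symp_conj !rmorphM.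
by rewrite rmorphN /= conjC_nat.
Qed.

Let mu := symp W W'.

Lemma mu_conj : mu^* = - mu.
Proof. by rewrite -symp_conj conjVK symp_anti. Qed.

Lemma S4_gamma x y : S4 T gC gC x y =
  S4 T W W x y + 2 * S4 T W W' x y + S4 T W' W' x y.
Proof.
rewrite gE S4Dl !(S4_C12 _ _ (W + W')) !S4Dl (S4_C12 _ W' W); ring.
Qed.

(** Three equal arguments W in S4 produce the factor <W, W> = 0, so of the binomial expansion of S4
    at W + W' only 6 S4(W, W, W', W') = -24 mu^2 survives. *)
Lemma I4_gamma : ratr (I4 gam) = - mu ^+ 2 :> C.
Proof.
have := S4_diag I4T gam => /(congr1 (ratr : rat -> C)).
rewrite -S4_map -/gC S4_gamma S4_W S4_W' => E.
apply: (@mulfI _ 24); first by rewrite pnatr_eq0.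
rewrite -[LHS](_ : ratr (24 * I4 gam) = _); last by rewrite rmorphM rmorph_nat.
rewrite -E.
have -> : S4 T W W' gC gC = S4 T gC gC W W' by rewrite S4_C23 S4_C12 S4_C34 S4_C23.
rewrite S4_gamma S4_W S4_W'.
have -> : S4 T W W' W W' = S4 T W W W' W' by rewrite S4_C23.
have e1 v : symp v gC = symp v W + symp v W' by rewrite gE sympDr.
rewrite S4_W !e1 !symp_self (symp_anti W' W) -/mu; ring.
Qed.

Lemma mu_neq0 : mu != 0.
Proof.
apply/eqP => m0; have := I4_gamma; rewrite m0 expr0n oppr0 => /eqP.
by rewrite fmorph_eq0 (negPf Hgam).
Qed.

Let la := - 4 * mu.

Lemma la_neq0 : la != 0.
Proof. by rewrite mulf_neq0 ?mu_neq0 // oppr_eq0 pnatr_eq0. Qed.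

Lemma la_conj : la^* = - la.
Proof. by rewrite rmorphM rmorphN /= conjC_nat mu_conj mulrN. Qed.

Lemma la_sqr : la ^+ 2 = ratr (- 16 * I4 gam).
Proof. by rewrite rmorphM rmorphN rmorph_nat /= I4_gamma /la; ring. Qed.

(** Both v and its conjugate lie in F^1, the orthogonal of om: v because F^2 is contained in F^1. *)
Lemma H21_symp v : H 1 v -> symp W v = 0 /\ symp W' v = 0.
Proof.
have [_ _ dec _] := HS; case=> F2v [w F1w wv]; have F1v : symp om v = 0 := dec 1%N v F2v.
have F1w' : symp om w = 0 := F1w.
by rewrite /W' /W -wv symp_conj !sympZl wv F1v F1w' !mulr0 rmorph0.
Qed.

Lemma H12_H21 v : H 2 v -> H 1 (conjV v).
Proof. exact: hodge_comp_conj. Qed.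

Lemma H12_symp v : H 2 v -> symp W v = 0 /\ symp W' v = 0.
Proof.
move/H12_H21/H21_symp => [h1 h2]; rewrite -[v]conjVK symp_conj h1 rmorph0.
by split=> //; rewrite -[W]conjVK symp_conj h2 rmorph0.
Qed.

Lemma H30_W v : H 0 v -> exists a, v = a *: om.
Proof. by case=> -[a _ <-] _; exists a. Qed.

(** Orthogonality to W and W' leaves the cross term 2 S4(W, W', v, w). By symmetry v, not W', is put
    in the tangent slot next to W, and the tangent formula gives -2 mu <v, w>. *)
Lemma S4_H21 v w : H 1 v -> S4 T gC gC v w = la * symp v w.
Proof.
move=> Hv; have [v1 v2] := H21_symp Hv; rewrite S4_gamma S4_W S4_W' v1 v2.
have [F2v _] := Hv.
have -> : S4 T W W' v w = - 2 * (mu * symp v w).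
  rewrite (S4_C23 _ W) /W S4Zl (S4_tangent I4T _ _ Oom F2v) -/W.
  by rewrite (symp_anti v W') v2 /mu /W sympZl; ring.
by rewrite /la; ring.
Qed.

Lemma gC_real : conjV gC = gC.
Proof. by apply/rowP => i; rewrite !mxE fmorph_rat. Qed.

Lemma S4_H12 v w : H 2 v -> S4 T gC gC v w = - la * symp v w.
Proof.
move/H12_H21 => Hv; rewrite -gC_real -[v]conjVK -[w]conjVK S4_conj S4_H21 //.
by rewrite [symp (conjV (conjV v)) _]symp_conj -la_conj -rmorphM.
Qed.

(** On the plane of W and W' the endomorphism is not diagonal: it sends W to 2 la W - la W', and its
    square there is 3 la^2. Applied to gamma = W + W', however, it yields a multiple of the
    difference W - W'. *)
Lemma S4_gamma3 w : S4 T gC gC gC w = 3 * la * (symp W w - symp W' w).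
Proof.
rewrite S4_gamma S4_W S4_W' (S4_C23 _ _ W') (S4_C12 _ W gC).
have -> : S4 T gC W W' w = S4 T W W W' w + S4 T W' W' W w.
  by rewrite gE S4Dl [S4 T W' W W' w]S4_C23.
rewrite S4_W S4_W' !gE !sympDr !symp_self (symp_anti W' W) -/mu /la; ring.
Qed.

(** Formed over Q, so that rationality is built in; that the Gram matrix is invertible enters after
    base change to C, where the polarization shows it. *)
Let A0 := (\matrix_(i, j) S4 T gam gam (delta_mx 0 i) (delta_mx 0 j))
  *m invmx (Vgram J rat).
Let A : 'M[C]_(Vdim J) := map_mx ratr A0.

Lemma symp_A v w : symp (v *m A) w = S4 T gC gC v w.
Proof.
rewrite symp_gram /A /A0 map_mxM map_invmx (Vgram_map _ (ratr : rat -> C)) mulmxA.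
rewrite mulmxKV ?Vgram_unit //.
rewrite (bilinear_gram (b := fun x y => S4 T gC gC x y)); first last.
- by move=> *; apply: S4_linear3.
- by move=> *; apply: S4_linear4.
congr ((v *m _ *m _) _ _); apply/matrixP => i j.
by rewrite !mxE -S4_map !map_delta_mx.
Qed.

Lemma symp_inj (v v' : 'rV[C]_(Vdim J)) : (forall w, symp v w = symp v' w) -> v = v'.
Proof.
move=> vv'; apply: subr0_eq; apply: symp_nondegenerate => w.
by rewrite sympBl vv' subrr.
Qed.

Lemma A_H21 v : H 1 v -> v *m A = la *: v.
Proof. by move=> Hv; apply: symp_inj => w; rewrite symp_A S4_H21 // sympZl. Qed.

Lemma A_H12 v : H 2 v -> v *m A = - la *: v.
Proof. by move=> Hv; apply: symp_inj => w; rewrite symp_A S4_H12 // sympZl. Qed.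

Lemma A_gamma : gC *m A = (3 * la) *: (W - W').
Proof.
apply: symp_inj => w; rewrite symp_A S4_gamma3 [RHS]sympZl; congr (_ * _).
by rewrite sympBl.
Qed.

(** The sum and the difference of W and W' are gamma and (3 la)^-1 times the image of gamma under
    [A], both with entries in Q(la). *)
Lemma W_inK : inKmx la W.
Proof.
have -> : W = ratr 2^-1 *: (gC + (ratr 3^-1 * la^-1) *: (gC *m A)).
  rewrite A_gamma scalerA !fmorphV !rmorph_nat.
  have -> : 3^-1 / la * (3 * la) = 1 :> C.
    by field; rewrite la_neq0.
  rewrite scale1r gE addrACA subrr addr0 -mulr2n -scaler_nat scalerA mulVf ?scale1r //.
  by rewrite pnatr_eq0.
have K2 : forall a, inK la (ratr a) by apply: inK_rat.
apply: (inKmxZ la_sqr) => //; apply: inKmxD; first exact: inKmx_rat.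
apply: (inKmxZ la_sqr).
  by apply: (inKM la_sqr) => //; apply: (inKV la_sqr la_neq0).
by apply: (inKmxM la_sqr); apply: inKmx_rat.
Qed.

(** The map v |-> (<v, W'> / mu) W: pairing with W' kills every Hodge component except H^{3,0}. *)
Let e30 : 'M[C]_(Vdim J) := mu^-1 *: ((Vgram J C *m W'^T) *m W).
Let e03 : 'M[C]_(Vdim J) := map_mx Num.conj e30.
(** Once H^{3,0} and H^{0,3} are removed, [A] has the eigenvalues la and - la, and (1 + A / la) / 2
    is the projector to the first eigenspace. *)
Let e21 : 'M[C]_(Vdim J) := ratr 2^-1 *: ((1%:M - (e30 + e03)) *m (1%:M + la^-1 *: A)).
Let e12 : 'M[C]_(Vdim J) := map_mx Num.conj e21.
Let e (p : 'I_4) := nth 0 [:: e30; e21; e12; e03] p.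

Lemma e30E v : v *m e30 = (symp v W' / mu) *: W.
Proof.
rewrite /e30 -scalemxAr !mulmxA [v *m _ *m _]mx11_scalar mul_scalar_mx scalerA.
by rewrite -symp_gram mulrC.
Qed.

Lemma conj_mul v (g : 'M[C]_(Vdim J)) : v *m map_mx Num.conj g = conjV (conjV v *m g).
Proof. by rewrite /conjV map_mxM -/(conjV _) -/(conjV _) conjVK. Qed.

Lemma e30_act (p : 'I_4) v : H p v -> v *m e30 = if p == 0 then v else 0.
Proof.
rewrite e30E; case: p => [[|[|[|[|//]]]] Hp] /= Hv.
- have [a ->] := H30_W Hv; have muE : mu = c * symp om W' by apply: sympZl.
  have := mu_neq0; rewrite muE mulf_eq0 negb_or => /andP[c0 s0].
  by rewrite sympZl scalerA; congr (_ *: _); field; rewrite c0 s0.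
- by have [_ h] := H21_symp Hv; rewrite symp_anti h oppr0 mul0r scale0r.
- by have [_ h] := H12_symp Hv; rewrite symp_anti h oppr0 mul0r scale0r.
- have /H30_W[a E] : H 0 (conjV v) by apply: hodge_comp_conj.
  rewrite -[v]conjVK E conjVZ sympZl.
  suff -> : symp (conjV om) W' = 0 by rewrite mulr0 mul0r scale0r.
  by rewrite symp_conj /W symp_anti sympZl symp_self mulr0 oppr0 rmorph0.
Qed.

Lemma H_conj (p : 'I_4) v : H p v -> H (rev_ord p) (conjV v).
Proof.
move=> Hv; have := hodge_comp_conj Hv; rewrite /H /= subSS subKn ?leq_ord //; exact.
Qed.

Lemma e03_act (p : 'I_4) v : H p v -> v *m e03 = if p == 3 then v else 0.
Proof.
move=> Hv; rewrite conj_mul (e30_act (H_conj Hv)).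
rewrite -(inj_eq rev_ord_inj p) (_ : rev_ord 3 = 0); last exact: val_inj.
by case: ifP => _; [rewrite conjVK | apply: map_mx0].
Qed.

Lemma e21_act (p : 'I_4) v : H p v -> v *m e21 = if p == 1 then v else 0.
Proof.
move=> Hv; rewrite /e21 -scalemxAr mulmxA mulmxBr mulmx1 [v *m (e30 + _)]mulmxDr.
rewrite (e30_act Hv) (e03_act Hv).
case: p Hv => [[|[|[|[|//]]]] Hp] /= Hv.
- by rewrite addr0 subrr mul0mx scaler0.
- rewrite addr0 subr0 mulmxDr mulmx1 -scalemxAr A_H21 // scalerA mulVf ?la_neq0 //.
  rewrite scale1r -mulr2n -scaler_nat scalerA fmorphV rmorph_nat mulVf ?scale1r //.
  by rewrite pnatr_eq0.
- rewrite addr0 subr0 mulmxDr mulmx1 -scalemxAr A_H12 // scalerA mulrN mulVf ?la_neq0 //.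
  by rewrite scaleN1r subrr scaler0.
- by rewrite add0r subrr mul0mx scaler0.
Qed.

Lemma e12_act (p : 'I_4) v : H p v -> v *m e12 = if p == 2 then v else 0.
Proof.
move=> Hv; rewrite conj_mul (e21_act (H_conj Hv)).
rewrite -(inj_eq rev_ord_inj p) (_ : rev_ord 2 = 1); last exact: val_inj.
by case: ifP => _; [rewrite conjVK | apply: map_mx0].
Qed.

Lemma e_act (p q : 'I_4) v : hodge_comp (CYfil om) (3 - p) p v ->
  v *m e q = if p == q then v else 0.
Proof.
move=> Hv; case: q => [[|[|[|[|//]]]] Hq]; rewrite /e /=.
- by rewrite (e30_act Hv).
- by rewrite (e21_act Hv).
- by rewrite (e12_act Hv).
- by rewrite (e03_act Hv).
Qed.

Lemma e_conj p : map_mx Num.conj (e p) = e (rev_ord p).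
Proof.
have K (B : 'M[C]_(Vdim J)) : map_mx Num.conj (map_mx Num.conj B) = B.
  by apply/matrixP => i j; rewrite !mxE; apply: conjCK.
by case: p => [[|[|[|[|//]]]] Hq]; rewrite /e /= ?K.
Qed.

Lemma e_inK p : inKmx la (e p).
Proof.
have K2 : forall a, inK la (ratr a) by apply: inK_rat.
have Kla := inKV la_sqr la_neq0.
have KC m n (B : 'M[C]_(m, n)) : inKmx la B -> inKmx la (map_mx Num.conj B).
  exact: (inKmx_conj la_conj).
have K1 : inKmx la (1%:M : 'M[C]_(Vdim J)).
  by rewrite -(map_mx1 (ratr : rat -> C)); apply: inKmx_rat.
have K30 : inKmx la e30.
  apply: (inKmxZ la_sqr).
    have -> : mu^-1 = ratr (- 4) * la^-1.
      by rewrite rmorphN rmorph_nat /la; field; rewrite mu_neq0.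
    exact: (inKM la_sqr).
  apply: (inKmxM la_sqr _ W_inK); apply: (inKmxM la_sqr).
    by rewrite -(Vgram_map J (ratr : rat -> C)); apply: inKmx_rat.
  by apply: inKmx_tr; apply: KC; apply: W_inK.
have K03 : inKmx la e03 by apply: KC.
have K21 : inKmx la e21.
  apply: (inKmxZ la_sqr) => //; apply: (inKmxM la_sqr); apply: inKmxD => //.
    by apply: (inKmxN la_sqr); apply: inKmxD.
  by apply: (inKmxZ la_sqr) => //; apply: inKmx_rat.
have K12 : inKmx la e12 by apply: KC.
by case: p => [[|[|[|[|//]]]] Hq].
Qed.

Lemma Jdim_gt0 : (0 < Jdim J)%N.
Proof. by case: J. Qed.

Lemma e_neq0 p : e p != 0.
Proof.
have conj0 (B : 'M[C]_(Vdim J)) : (map_mx Num.conj B == 0) = (B == 0).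
  by rewrite map_mx_eq0.
have e30n0 : e30 != 0.
  apply/eqP => e0; have := e30E W; rewrite e0 mulmx0 divff ?mu_neq0 // scale1r => W0.
  by case/negP: mu_neq0; rewrite /mu -W0 -[0](scale0r om) sympZl mul0r.
have e21n0 : e21 != 0.
  (* Otherwise 1 = e30 + e03 has rank at most 2, whereas dim V >= 4. *)
  apply/eqP => e0; have e12_0 : e12 = 0 by rewrite /e12 e0 map_mx0.
  have := projector_sum HS e_act.
  rewrite !big_ord_recl big_ord0 /= /e /= e0 e12_0 addr0 !add0r => E.
  have rk : (\rank e30 <= 1)%N.
    by apply: leq_trans (mxrankS (scalemx_sub _ (submxMl _ _))) (rank_leq_row W).
  have := congr1 mxrank E; rewrite mxrank1 => rkE.
  have := mxrank_add e30 e03; rewrite rkE mxrank_map leqNgt => /negP[].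
  apply: (leq_ltn_trans (leq_add rk rk)); rewrite /Vdim.
  by case: (Jdim J) Jdim_gt0 => // n _; rewrite !(addSn, addnS).
by case: p => [[|[|[|[|//]]]] Hq]; rewrite /e /= ?conj0.
Qed.

Lemma attractor_CM : CM_point om.
Proof.
exact: (mumford_tate_torus HS e_act la_conj la_sqr la_neq0 e_neq0 e_conj e_inK).
Qed.

End Attractor.

Theorem theorem1p0p3 (R : realType) (J : jordan) (HJ : admissible R J)
    (M : set 'rV[R[i]]_(Vdim J)) (HM : CYdomain M)
    (gam : 'rV[rat]_(Vdim J)) (Hgam : 0 < I4 gam)
    (x : 'rV[R[i]]_(Vdim J)) (Hx : M x) :
  attractor_point gam x -> CM_point x.
Proof.
have [_ [U _ MU] /(_ x Hx)[HS pol]] := HM.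
have Ox : Ocone x by move: Hx; rewrite MU => -[].
have [T I4T] := I4_hom J.
case=> v [w [[[a _ <-] _] [_ [_ [b _ <-] <-]] gE]].
have real_gam : conjV (map_mx ratr gam) = map_mx ratr gam :> 'rV[R[i]]_(Vdim J).
  by apply/rowP => i; rewrite !mxE fmorph_rat.
(* The attractor condition gives gamma = a x + conj (b x) with unrelated scalars a and b. Reality of
   gamma makes (a - b) x a real vector of F^3. *)
have ab : (a - b) *: x = 0.
  apply: (fil3_real HS); first by exists (a - b).
  rewrite scalerBl conjVD conjVN; move: real_gam.
  by rewrite gE conjVD conjVK => /(canRL (addrK _)) ->; rewrite addrAC addrK.
apply: (attractor_CM I4T (c := a) Ox HS pol (lt0r_neq0 Hgam)).
rewrite gE; congr (_ + conjV _).
by apply/eqP; rewrite eq_sym -subr_eq0 -scalerBl ab.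
Qed.
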